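(* Let $\alpha\in(0,1)$, let $T(G_n)=N_m(n)-n\,p_m(\delta_0)$, and define the test $$\psi_{\rm cal}(G_n)=\mathbf 1\left\{|T(G_n)|\ge\sqrt{n\,w(\delta_0,m)}\;z_{\alpha/2}\right\}.$$ As $n\to\infty$, the type-I error of this test converges to $\alpha$: $\mathbb P_0(\psi_{\rm cal}(G_n)\ne0)\to\alpha$. Furthermore, when $\delta_0\ne\delta_1$ and $\tfrac12<\gamma<1$, the type-II error vanishes: $\mathbb P_1(\psi_{\rm cal}(G_n)=0)\to0$ as $n\to\infty$.
   Context: Model. Fix an integer $m\ge1$ and a function $\delta:\mathbb N\to(-m,\infty)$. A random sequence of undirected loopless graphs $(G_t)_{t\ge1}$ (multiple edges allowed, degrees counted with multiplicity) is built as follows. $G_1$ has vertices $v_0,v_1$ joined by $m$ edges. For $t\ge2$, $G_{t,0}$ is $G_{t-1}$ plus an isolated vertex $v_t$; for $i=1,\dots,m$, given $G_{t,i-1}$, a vertex $v_{t,i}\in\{v_0,\dots,v_{t-1}\}$ is sampled with $\mathbb P(v_{t,i}=v\mid G_{t,i-1})=\frac{D_v(G_{t,i-1})+\delta(t)}{\sum_{j=0}^{t-1}(D_{v_j}(G_{t,i-1})+\delta(t))}$, where $D_v(G)$ is the degree of $v$ in $G$, and $G_{t,i}$ is $G_{t,i-1}$ plus the edge $\{v_{t,i},v_t\}$; finally $G_t=G_{t,m}$. Vertices are identified with $[n]=\{0,1,\dots,n\}$, $D_v(t)=D_v(G_t)$, and $N_k(t)=\#\{v\in[t]:D_v(t)=k\}$.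 Null model ($\mathbb P_0,\mathbb E_0$): $\delta(t)=\delta_0$ for all $t$. Alternative model ($\mathbb P_1,\mathbb E_1$): $\delta(t)=\delta_0$ for $t\le\tau_n$ and $\delta(t)=\delta_1$ for $t>\tau_n$, with $\delta_0,\delta_1>-m$ and $\tau_n=n-cn^\gamma$ (rounded down to an integer), $c>0$, $\gamma\in(0,1)$. The constants $m,\delta_0,\delta_1,c,\gamma$ are fixed as $n\to\infty$. The parameter $\delta_0$ is known to the test. $p_m(\delta)=\dfrac{2+\delta/m}{m+\delta+2+\delta/m}$ for $\delta>-m$, and $$w(\delta_0,m)=\frac{m^2(m+\delta_0)(1+m+\delta_0)(2m+\delta_0)}{(\delta_0+2m(1+m+\delta_0))\,(\delta_0+m(2+m+\delta_0))^2}.$$ For $\alpha\in(0,1)$, $z_\alpha$ is the unique solution of $\alpha=\int_{z_\alpha}^\infty\frac1{\sqrt{2\pi}}e^{-z^2/2}\,dz$. *)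

(* Defs.v *)
From HB Require Import structures.
From mathcomp Require Import all_boot all_order all_algebra.
From mathcomp Require Import all_classical all_reals all_analysis.
Set Implicit Arguments.
Unset Strict Implicit.
Unset Printing Implicit Defensive.
Import Order.TTheory GRing.Theory Num.Theory.
Import numFieldNormedType.Exports.
Local Open Scope classical_set_scope.
Local Open Scope ring_scope.

(* A multigraph is given by the list of its edges; two lists represent the same
   multigraph when they are equal up to permutation (perm_eq).  All edges occurring
   below are listed with their older endpoint first, so an undirected edge has a
   single representation.  The vertices of G_t are 0, ..., t. *)
Definition multigraph := seq (nat * nat).

Definition degree (G : multigraph) (u : nat) : nat :=
  (\sum_(e <- G) ((e.1 == u) + (e.2 == u)))%N.

(* v t i is the vertex v_{t,i} chosen by the i-th edge of vertex t, for
   1 <= i <= m; its values at other indices are not used. *)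
Fixpoint add_edges (v : nat -> nat -> nat) (t i : nat) (G : multigraph)
    : multigraph :=
  if i is j.+1 then (v t i, t) :: add_edges v t j G else G.

(* G_t, for t >= 1; the value at t = 0 is a dummy. *)
Fixpoint pa_graph (m : nat) (v : nat -> nat -> nat) (t : nat) : multigraph :=
  match t with
  | 0 => [::]
  | 1 => nseq m (0, 1)%N
  | s.+1 => add_edges v t m (pa_graph m v s)
  end.

(* G_{t,i}, for t >= 2 *)
Definition pa_subgraph (m : nat) (v : nat -> nat -> nat) (t i : nat)
    : multigraph :=
  add_edges v t i (pa_graph m v t.-1).

Definition attach_prob (R : realType) (dt : R) (t : nat) (G : multigraph)
    (u : nat) : R :=
  ((degree G u)%:R + dt) / \sum_(j < t) ((degree G j)%:R + dt).

(* The conditional law P(v_{t,i} = u | G_{t,i-1}) is stated in product form, so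
   that nothing is required on events {G_{t,i-1} = g} of probability zero. *)
Definition is_pa_process (R : realType) (m : nat) (delta : nat -> R)
    (d : measure_display) (T : measurableType d) (P : probability T R)
    (v : nat -> nat -> T -> nat) : Prop :=
  forall t i : nat, (2 <= t)%N -> (1 <= i <= m)%N ->
    [/\ measurable_fun setT (v t i),
        forall w : T, (v t i w < t)%N &
        forall (g : multigraph) (u : nat), (u < t)%N ->
          let Gti w := pa_subgraph m (fun s j => v s j w) t i.-1 in
          (P [set w | v t i w = u /\ perm_eq (Gti w) g] =
           (attach_prob (delta t) t g u)%:E * P [set w | perm_eq (Gti w) g])%E].

Definition random_graph (m : nat) (T : Type) (v : nat -> nat -> T -> nat)
    (n : nat) (w : T) : multigraph :=
  pa_graph m (fun t i => v t i w) n.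

Definition changepoint (R : realType) (c gamma : R) (n : nat) : int :=
  Num.floor (n%:R - c * n%:R `^ gamma).

Definition delta_null (R : realType) (delta0 : R) : nat -> R := fun=> delta0.

Definition delta_alt (R : realType) (delta0 delta1 : R) (tau : int) : nat -> R :=
  fun t => if t%:Z <= tau then delta0 else delta1.

Definition num_degree (k n : nat) (G : multigraph) : nat :=
  #|[pred u : 'I_n.+1 | degree G u == k]|.

Definition p_m (R : realType) (m : nat) (delta : R) : R :=
  (2 + delta / m%:R) / (m%:R + delta + 2 + delta / m%:R).

Definition w_var (R : realType) (delta0 : R) (m : nat) : R :=
  (m%:R ^+ 2 * (m%:R + delta0) * (1 + m%:R + delta0) * (2 * m%:R + delta0)) /
  ((delta0 + 2 * m%:R * (1 + m%:R + delta0)) *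
   (delta0 + m%:R * (2 + m%:R + delta0)) ^+ 2).

(* z_alpha; the default value 0 is never used when 0 < alpha < 1. *)
Definition z_quantile (R : realType) (alpha : R) : R :=
  xget 0 [set z : R | alpha%:E =
    (\int[lebesgue_measure]_(x in `[z, +oo[) (normal_pdf 0 1 x)%:E)%E].

Definition T_stat (R : realType) (m : nat) (delta0 : R) (n : nat)
    (G : multigraph) : R :=
  (num_degree m n G)%:R - n%:R * p_m m delta0.

Definition psi_cal (R : realType) (m : nat) (delta0 alpha : R) (n : nat)
    (G : multigraph) : nat :=
  (Num.sqrt (n%:R * w_var delta0 m) * z_quantile (alpha / 2)
     <= `|T_stat m delta0 n G|)%R.

(* Main.v *)
(* Since every vertex enters with degree m, a vertex of degree m that receives an edge
   leaves the count for ever, and every other degree stays above m.  So the number X of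
   vertices of degree m, observed after each edge, is a time-inhomogeneous Markov chain:
   it drops by one with probability (m + delta) X / S, where S is the deterministic total
   weight.  Centred by its linear approximation it becomes an autoregression
   Y -> Y + q - Bernoulli(a (Y + c)) with a ~ theta / k.  Its central limit theorem follows
   by Lindeberg's method: the functions Phi ((b - A y) / sqrt V) of the state y are
   explicit solutions of the backward heat equation, so no characteristic function is
   needed, and they also serve as smoothings of the half-line indicators.  Under the
   alternative the variance is still O(n), while the mean moves by a multiple of
   n^gamma, which dominates sqrt n, and Chebyshev's inequality concludes. *)
Require Import Defs.
From HB Require Import structures.
From mathcomp Require Import all_boot all_order all_algebra.
From mathcomp Require Import all_classical all_reals all_analysis.
From mathcomp Require Import measurable_realfun ring lra zify.
Import Order.TTheory GRing.Theory Num.Theory.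
Import numFieldNormedType.Exports.
Local Open Scope classical_set_scope.
Local Open Scope ring_scope.

(** The limiting variance comes from a balance: if the variance of the autoregression is about
    [w k], one step turns it into [(1 - theta/k)^2 w k + q (1 - q)], whence
    [q (1 - q) = w (1 + 2 theta)]. If [A] is the contraction left between time [k] and the horizon
    [K], the noise still to come then has variance [w (K - A^2 k)]. A smoothing variance
    [v = eps^2 n] is added to it, so that [V] never falls below [v], even at the last steps where
    hardly any noise remains.

    The obstacle is that the jump probability depends on the state: it differs from [q] by
    [O((|y| + 1) / k)]. A second moment bound gives [|y| = O(sqrt k)] on average, so the mismatch of
    variances at step [k] is [O(k^(-1/2) / n)] and its sum vanishes. For fixed [eps] the total error
    is [O(n^(-1/4))]; [eps] is made small independently of [n].

    All this is done for an abstract positive functional [L] with a one-step rule. Graphs enter only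
    when that rule is checked, and the same variance bound serves both models. *)

Section mean_value_bounds.
Context {R : realType}.
Implicit Types (f df ddf dddf : R -> R) (x y h M : R).

(** * Mean value inequality and Taylor remainders *)

Lemma norm_sub_le_of_derive f df x y M :
  (forall z, `|z - x| <= `|y - x| -> is_derive z 1 f (df z)) ->
  (forall z, `|z - x| <= `|y - x| -> `|df z| <= M) ->
  `|f y - f x| <= M * `|y - x|.
Proof.
move=> fd dfM.
have cont a b : (forall z, z \in `[a, b] -> `|z - x| <= `|y - x|) ->
    {within `[a, b], continuous f}.
  move=> H; apply: derivable_within_continuous => z /H /fd zd.
  by apply: ex_derive.
have [xy|yx|->] := ltgtP x y; last by rewrite !subrr !normr0 mulr0.
- have bnd z : z \in `[x, y] -> `|z - x| <= `|y - x|.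
    by rewrite in_itv /= => /andP[xz zy]; rewrite !ger0_norm; lra.
  have [|c cxy ->] := @MVT R f df x y xy _ (cont _ _ bnd).
    by move=> z zxy; apply: fd; apply: bnd; apply: subset_itv_oo_cc zxy.
  rewrite normrM ler_wpM2r// dfM// bnd//; exact: subset_itv_oo_cc cxy.
- have bnd z : z \in `[y, x] -> `|z - x| <= `|y - x|.
    by rewrite in_itv /= => /andP[xz zy]; rewrite !ler0_norm; lra.
  have [|c cxy E] := @MVT R f df y x yx _ (cont _ _ bnd).
    by move=> z zxy; apply: fd; apply: bnd; apply: subset_itv_oo_cc zxy.
  rewrite distrC E distrC normrM ler_wpM2r// dfM// bnd//.
  exact: subset_itv_oo_cc cxy.
Qed.

(** Subtracting the linear part from [f] leaves a function with derivative [df z - df x], at most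
    [M |h|] on the ball; two mean value inequalities give the right order without the sharp
    constant. The hypotheses are local because the expansion in the variance is singular at
    [1 + z = 0]. *)
Lemma taylor1_bound f df ddf x h M :
  (forall z, `|z - x| <= `|h| -> is_derive z 1 f (df z)) ->
  (forall z, `|z - x| <= `|h| -> is_derive z 1 df (ddf z)) ->
  (forall z, `|z - x| <= `|h| -> `|ddf z| <= M) ->
  `|f (x + h) - f x - h * df x| <= M * h ^+ 2.
Proof.
move=> fd dfd ddfM.
have M0 : 0 <= M by apply: le_trans (ddfM x _); rewrite ?subrr ?normr0.
pose g z := f z - z * df x.
have -> : f (x + h) - f x - h * df x = g (x + h) - g x by rewrite /g; ring.
have -> : M * h ^+ 2 = M * `|h| * `|x + h - x|.
  rewrite (_ : x + h - x = h); last by ring.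
  by rewrite -(real_normK (num_real h)); ring.
apply: (norm_sub_le_of_derive g (fun z => df z - df x)).
  move=> z; rewrite addrAC subrr add0r => zh; have := fd _ zh => ?.
  apply: is_deriveB; apply: is_derive_eq.
  by rewrite scaler0 add0r /GRing.scale /= mulr1.
move=> z; rewrite addrAC subrr add0r => zh.
apply: (le_trans (norm_sub_le_of_derive df ddf x z M _ _)).
- by move=> u uz; apply: dfd; apply: le_trans zh.
- by move=> u uz; apply: ddfM; apply: le_trans zh.
- exact: ler_wpM2l.
Qed.

Lemma taylor2_bound f df ddf dddf x h M :
  (forall z : R, is_derive z 1 f (df z)) ->
  (forall z : R, is_derive z 1 df (ddf z)) ->
  (forall z : R, is_derive z 1 ddf (dddf z)) ->
  (forall z, `|dddf z| <= M) ->
  `|f (x + h) - f x - h * df x - h ^+ 2 / 2 * ddf x| <= M * `|h| ^+ 3.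
Proof.
move=> fd dfd ddfd dddfM.
have M0 : 0 <= M by apply: le_trans (dddfM x).
pose g z := f z - z * df x - (z - x) ^+ 2 / 2 * ddf x.
have -> : f (x + h) - f x - h * df x - h ^+ 2 / 2 * ddf x = g (x + h) - g x.
  by rewrite /g; field.
have -> : M * `|h| ^+ 3 = M * h ^+ 2 * `|x + h - x|.
  rewrite (_ : x + h - x = h); last by ring.
  by rewrite exprS -(real_normK (num_real h)); ring.
apply: (norm_sub_le_of_derive g (fun z => df z - df x - (z - x) * ddf x)).
  move=> z _; have ? := fd z.
  apply: is_derive_eq.
  by rewrite !scaler0 !add0r /GRing.scale /= ?expr1 /cst; field.
move=> z; rewrite (_ : x + h - x = h); last by ring.
move=> zh; have -> : df z = df (x + (z - x)) by congr df; ring.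
apply: (le_trans (taylor1_bound df ddf dddf x (z - x) M _ _ _)) => //.
apply: ler_wpM2l => //.
rewrite -(real_normK (num_real h)) -(real_normK (num_real (z - x))).
by apply: lerXn2r; rewrite ?nnegrE.
Qed.

End mean_value_bounds.

(** * The standard normal distribution function and its quantiles *)

Section standard_normal.
Context {R : realType}.
Implicit Types x y z e h : R.
Notation mu := (@lebesgue_measure R).

Definition gauss x : R := normal_pdf 0 1 x.

Definition Phi x : R := \int[mu]_(t in `]-oo, x]) gauss t.

Lemma gaussE x : gauss x = normal_peak 1 * expR (- x ^+ 2 / 2).
Proof. by rewrite /gauss normal_pdfE ?oner_eq0// /normal_fun subr0 expr1n. Qed.

Lemma gauss_ge0 x : 0 <= gauss x. Proof. exact: normal_pdf_ge0. Qed.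

Lemma gaussN x : gauss (- x) = gauss x.
Proof. by rewrite !gaussE sqrrN. Qed.

Lemma integrable_gauss (D : set R) : measurable D ->
  mu.-integrable D (EFin \o gauss).
Proof.
by move=> mD; apply: integrableS (integrable_normal_pdf _ _) => //; exact: subsetT.
Qed.

Lemma PhiE x : (Phi x)%:E = normal_prob 0 1 `]-oo, x]%classic.
Proof.
rewrite /Phi /Rintegral fineK//; apply: integrable_fin_num => //.
exact: integrable_gauss.
Qed.

Lemma Phi_ge0 x : 0 <= Phi x.
Proof. by rewrite -lee_fin PhiE. Qed.

Lemma Phi_le1 x : Phi x <= 1.
Proof. by rewrite -lee_fin PhiE probability_le1. Qed.

Lemma Phi_le x y : x <= y -> Phi x <= Phi y.
Proof.
move=> xy; rewrite -lee_fin !PhiE; apply: le_measure; rewrite ?inE//.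
by apply: subset_itvl; rewrite bnd_simp.
Qed.

Lemma integral_gauss_tail z :
  (\int[mu]_(x in `[z, +oo[) (normal_pdf 0 1 x)%:E)%E = (Phi (- z))%:E.
Proof.
rewrite PhiE /normal_prob ge0_integration_by_substitutionNy.
- by apply: eq_integral => x _ /=; rewrite [LHS](_ : _ = (gauss x)%:E)// -gaussN.
- by apply: continuous_subspaceT; apply: continuous_normal_pdf; rewrite oner_eq0.
- by move=> x _; exact: normal_pdf_ge0.
Qed.

Lemma PhiN x : Phi (- x) = 1 - Phi x.
Proof.
apply/eqP; rewrite eq_sym subr_eq eq_sym addrC; apply/eqP/EFin_inj.
rewrite EFinD -(integral_gauss_tail x) PhiE.
rewrite -[RHS](integral_normal_pdf (R := R) 0 1) -(@integral_itv_obnd_cbnd R x); last first.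
  apply/measurable_EFinP; apply: measurable_funS (measurable_normal_pdf 0 1) => //.
rewrite -ge0_integral_setU//=.
- by rewrite -itv_bndbnd_setU// set_itvNyy.
- apply/measurable_EFinP; apply: measurable_funS (measurable_normal_pdf 0 1) => //.
- by move=> u _; rewrite lee_fin normal_pdf_ge0.
- exact: (@disjoint_rays _ _ false x).
Qed.

Lemma is_derive_Phi x : is_derive x 1 Phi (gauss x).
Proof.
have [||||d e] := @continuous_FTC1 R gauss -oo%O x (x + 1).
- by rewrite ltrDl.
- exact: integrable_gauss.
- exact: ltNyr.

- by apply: continuous_normal_pdf; rewrite oner_eq0.
by apply: (DeriveDef d); rewrite -derive1E e.
Qed.

Lemma is_derive_gauss x : is_derive x 1 gauss (- (x * gauss x)).
Proof.
rewrite (_ : gauss = fun y => normal_peak 1 * expR (- y ^+ 2 / 2)); last first.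
  by apply/funext => y; rewrite gaussE.
apply: is_derive_eq; rewrite /GRing.scale /= ?scaler0 ?add0r ?expr1 /cst.
by field.
Qed.

Lemma Phi_lt_eps e : 0 < e -> exists2 M, 0 < M & Phi (- M) < e.
Proof.
move=> e0.
pose F n : set R := `]-oo, - (n%:R : R)]%classic.
have F0 : \bigcap_n F n = set0.
  rewrite -subset0 => x /= Fx.
  have := Fx (Num.truncn `|x|).+1 I; rewrite /F /= in_itv /= lerNr.
  by rewrite leNgt (le_lt_trans (ler_norm (- x)))// normrN truncnS_gt.
have FE n : normal_prob 0 1 (F n) = (Phi (- n%:R))%:E by rewrite PhiE.
have : (fun n => (Phi (- n%:R))%:E) @ \oo --> 0%E.
  rewrite (_ : (fun n => _) = normal_prob 0 1 \o F); last first.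
    by apply/funext => n; rewrite -FE.
  rewrite -[0%E](measure0 (normal_prob 0 1 : probability _ R)) -F0.
  apply: nonincreasing_cvg_mu.
  - apply: (@le_lt_trans _ _ 1%E); last exact: ltry.
    by apply: probability_le1; exact: measurable_itv.
  - by move=> n; exact: measurable_itv.
  - by rewrite F0.
  - move=> a b ab; apply/subsetPset; apply: subset_itvl.
    by rewrite bnd_simp lerN2 ler_nat.
move=> /fine_cvgP[_ /cvgrPdist_lt /(_ _ e0)[N _ /(_ N.+1)]].
rewrite /= => /(_ (leqnSn N)); rewrite sub0r normrN.
by rewrite ger0_norm ?Phi_ge0// => H; exists (N.+1%:R).
Qed.

Lemma Phi0 : Phi 0 = 1 / 2.
Proof. by have := PhiN 0; rewrite oppr0 => h; lra. Qed.

(** By symmetry [Phi (- z)] is the upper tail at [z]. The intermediate value theorem solves the tail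
    equation, so [xget] returns a solution and not its default. *)
Lemma z_quantileP (a : R) : 0 < a < 1 -> Phi (- z_quantile a) = a.
Proof.
move=> /andP[a0 a1].
have [M M0 HM] : exists2 M, 0 < M & Phi (- M) < a by exact: Phi_lt_eps.
have [N N0 HN] : exists2 N, 0 < N & Phi (- N) < 1 - a.
  by apply: Phi_lt_eps; rewrite subr_gt0.
have [| | |c _ Hc] := @IVT R Phi (- M) N a.
- by lra.
- by apply: derivable_within_continuous => z _; have := is_derive_Phi z => ?; apply: ex_derive.
- have := PhiN N => E; rewrite ge_min le_max.
  by apply/andP; split; apply/orP; [left|right]; lra.
rewrite /z_quantile; case: xgetP => [z _ /= E|/(_ (- c))[]]; last first.
  by rewrite /= integral_gauss_tail opprK Hc.
by apply/EFin_inj; rewrite -integral_gauss_tail -E.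
Qed.

End standard_normal.

(** * Uniform Taylor bounds for [Phi] in space and in variance *)

Section heat_kernel_bounds.
Context {R : realType}.
Implicit Types x y z e h r : R.

(** Degree 4 dominates the polynomial factors met in the derivatives of [Phi], all of degree at most
    3. The constant comes from [1 + x^4 <= 16 (1 + x^2/4)^2 <= 16 exp (x^2/2)], the peak of the
    density being at most 1. *)
Lemma gauss_quartic_bound x : (1 + x ^+ 4) * gauss x <= 16.
Proof.
have peak1 : normal_peak (1 : R) <= 1.
  have pi1 : 1 <= (pi : R) *+ 2 by have := pi_ge2 R; lra.
  have pi0 := lt_le_trans ltr01 pi1.
  rewrite /normal_peak expr1n mul1r invf_le1 ?sqrtr_gt0//.
  by rewrite -[leLHS]sqrtr1 ler_wsqrtr.
have E0 := expR_gt0 (- x ^+ 2 / 2).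
have g_le : gauss x <= expR (- x ^+ 2 / 2).
  by rewrite gaussE ler_piMl// ltW.
have exp_ge : 1 + x ^+ 2 / 4 <= expR (x ^+ 2 / 4) by exact: expR_ge1Dx.
have EE : expR (- x ^+ 2 / 2) * expR (x ^+ 2 / 4) ^+ 2 = 1.
  by rewrite (expr2 (expR _)) -!expRD (_ : _ + _ = 0) ?expR0//; field.
have p0 : 0 <= x ^+ 2 / 4 by have := sqr_ge0 x; lra.
have sq : (1 + x ^+ 2 / 4) ^+ 2 <= expR (x ^+ 2 / 4) ^+ 2.
  by rewrite lerXn2r ?nnegrE//; lra.
have x4 : 1 + x ^+ 4 <= 16 * (1 + x ^+ 2 / 4) ^+ 2.
  rewrite (_ : x ^+ 4 = (x ^+ 2) ^+ 2); last by rewrite -exprM.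
  have := sqr_ge0 x; nra.
have : (1 + x ^+ 4) * gauss x <=
    16 * expR (x ^+ 2 / 4) ^+ 2 * expR (- x ^+ 2 / 2).
  apply: ler_pM => //; last by lra.
  - by rewrite addr_ge0// -[4%N]/(2 * 2)%N exprM sqr_ge0.
  - exact: gauss_ge0.
by rewrite -mulrA [X in 16 * X]mulrC EE mulr1.
Qed.

Lemma norm_mul_gauss_le y z : `|y| <= 2 * (1 + z ^+ 4) -> `|y * gauss z| <= 32.
Proof.
move=> yz; rewrite normrM (ger0_norm (gauss_ge0 z)).
have := gauss_quartic_bound z; have := gauss_ge0 z; nra.
Qed.

Lemma is_derive_mul_gauss x :
  is_derive x 1 (fun y => y * gauss y) ((1 - x ^+ 2) * gauss x).
Proof.
have ? := is_derive_gauss x.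
by apply: is_derive_eq; rewrite /GRing.scale /=; ring.
Qed.

Lemma Phi_taylor2 x h :
  `|Phi (x + h) - Phi x - h * gauss x + h ^+ 2 / 2 * (x * gauss x)|
  <= 32 * `|h| ^+ 3.
Proof.
have -> : Phi (x + h) - Phi x - h * gauss x + h ^+ 2 / 2 * (x * gauss x) =
  Phi (x + h) - Phi x - h * gauss x - h ^+ 2 / 2 * - (x * gauss x) by ring.
apply: (taylor2_bound Phi gauss (fun y => - (y * gauss y))
          (fun y => - ((1 - y ^+ 2) * gauss y))).
- exact: is_derive_Phi.
- exact: is_derive_gauss.
- by move=> z; have ? := is_derive_mul_gauss z; exact: is_deriveN.
- move=> z; rewrite normrN; apply: norm_mul_gauss_le.
  rewrite (_ : z ^+ 4 = (z ^+ 2) ^+ 2); last by rewrite -exprM.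
  by rewrite ler_norml; have := sqr_ge0 z; nra.
Qed.

(* Taylor expansion of [v |-> Phi (x / sqrt v)] at [v], with [r = x / sqrt v] and
   relative increment [e]: the first-order term is half the second derivative in
   [x], i.e. [Phi (x / sqrt v)] solves the heat equation. *)
Lemma Phi_variance_taylor1 r e : `|e| <= 1 / 2 ->
  `|Phi (r / Num.sqrt (1 + e)) - Phi r + e / 2 * (r * gauss r)| <= 128 * e ^+ 2.
Proof.
move=> e12.
pose s z := Num.sqrt (1 + z).
have zpos z : `|z - 0| <= `|e| -> 1 / 2 <= 1 + z.
  by rewrite subr0 => /le_trans/(_ e12); rewrite ler_norml; lra.
have s0 z : `|z - 0| <= `|e| -> 0 < s z.
  by move/zpos => h; rewrite sqrtr_gt0; lra.
have sE z : `|z - 0| <= `|e| -> 1 + z = s z ^+ 2.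
  by move/zpos => h; rewrite sqr_sqrtr//; lra.
have ds z : `|z - 0| <= `|e| -> is_derive z 1 (fun y => r / s y) (- (r / s z) / (2 * (1 + z))).
  move=> ze; have z1 : 0 < 1 + z by have := zpos _ ze; lra.
  have ? : is_derive z 1 s (2 * s z)^-1.
    apply: is_derive_eq (@is_derive1_comp _ _ _ _ _ _ (is_derive1_sqrt z1) _) _.
    by rewrite add0r mulr1.
  have sz := s0 _ ze; have snz : s z != 0 by rewrite gt_eqF.
  apply: is_derive_eq; rewrite /GRing.scale /= (sE _ ze) ?mulr0 ?scaler0 ?addr0; field.
  by [].
have := taylor1_bound (fun z => Phi (r / s z))
  (fun z => - ((r / s z) * gauss (r / s z)) / (2 * (1 + z)))
  (fun z => (3 / 4 * (r / s z) - (r / s z) ^+ 3 / 4) * gauss (r / s z) / (1 + z) ^+ 2)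
  0 e 128.
rewrite /s add0r addr0 sqrtr1 divr1 mulr1 => H.
apply: le_trans (H _ _ _); first by rewrite le_eqVlt; apply/orP; left; apply/eqP; congr `|_|; field.
- move=> z ze; have ? := ds _ ze; have ? := is_derive_Phi (r / s z).
  have -> : - (r / s z * gauss (r / s z)) / (2 * (1 + z)) =
      gauss (r / s z) * (- (r / s z) / (2 * (1 + z))) by ring.
  exact: (is_derive1_comp (f := Phi) (g := fun y => r / s y)).
- move=> z ze; have ? := ds _ ze; have ? := is_derive_mul_gauss (r / s z).
  have h := zpos _ ze; have z0 : 1 + z != 0 by rewrite gt_eqF//; lra.
  have z20 : 2 * (1 + z) != 0 by rewrite mulf_neq0.
  have ? : is_derive z 1 (fun y => - ((fun y => y * gauss y) \o (fun y => r / s y)) y * (2 * (1 + y))^-1) ((3 / 4 * (r / s z) - (r / s z) ^+ 3 / 4) * gauss (r / s z) / (1 + z) ^+ 2).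
    apply: is_derive_eq; rewrite /GRing.scale /= ?mulr0 ?scaler0 ?addr0 ?add0r.
    by generalize (r / s z) => y; field.
  by [].
- move=> z ze; have h := zpos _ ze.
  set y := r / s z.
  have B : `|(3 / 4 * y - y ^+ 3 / 4) * gauss y| <= 32.
    apply: norm_mul_gauss_le; rewrite ler_norml.
    have := sqr_ge0 (y - 1); have := sqr_ge0 (y + 1); have := sqr_ge0 (y ^+ 2 - 1).
    have := sqr_ge0 (y ^+ 2 - y); have := sqr_ge0 (y ^+ 2 + y).
    by move=> *; apply/andP; split; lra.
  (* Dividing by [(1 + z)^2] costs a factor 4, hence the constant [128 = 32 * 4]. *)
  have p2 : 1 / 4 <= (1 + z) ^+ 2 by nra.
  rewrite normrM normfV (ger0_norm (sqr_ge0 _)) ler_pdivrMr; last by lra.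
  by lra.
Qed.

End heat_kernel_bounds.

(** * Sums of inverse powers *)

Section sum_bounds.
Context {R : realType}.

Lemma sum_invsqrt_le k :
  \sum_(j < k) (Num.sqrt (j.+1%:R : R))^-1 <= 2 * Num.sqrt k%:R.
Proof.
elim: k => [|k IH]; first by rewrite big_ord0 sqrtr0 mulr0.
rewrite big_ord_recr /=.
set x := Num.sqrt k%:R in IH *; set y := Num.sqrt k.+1%:R.
have x2 : x ^+ 2 = k%:R by rewrite sqr_sqrtr.
have y2 : y ^+ 2 = k%:R + 1 by rewrite sqr_sqrtr// -natr1.
have x0 : 0 <= x by exact: sqrtr_ge0.
have y0 : 0 < y by rewrite sqrtr_gt0 ltr0n.
have yi : y^-1 <= 2 * (y - x) by rewrite -[y^-1]mul1r ler_pdivrMr//; nra.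
by lra.
Qed.

(** Any power below [sqrt k] is good enough for the harmonic sum, and the fourth root avoids
    logarithms: from [y^4 - x^4 = 1] and [y >= 1] the increment [y - x] is at least
    [1 / (4 y^4)]. *)
Lemma sum_inv_le k :
  \sum_(j < k) (j.+1%:R : R)^-1 <= 4 * Num.sqrt (Num.sqrt k%:R).
Proof.
elim: k => [|k IH]; first by rewrite big_ord0 !sqrtr0 mulr0.
rewrite big_ord_recr /=.
set x := Num.sqrt (Num.sqrt k%:R) in IH *; set y := Num.sqrt (Num.sqrt k.+1%:R).
have x4 : x ^+ 4 = k%:R by rewrite -[4%N]/(2 * 2)%N exprM !sqr_sqrtr ?sqrtr_ge0.
have y4 : y ^+ 4 = k%:R + 1.
  by rewrite -[4%N]/(2 * 2)%N exprM !sqr_sqrtr ?sqrtr_ge0// -natr1.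
have x0 : 0 <= x by exact: sqrtr_ge0.
have y1 : 1 <= y.
  by rewrite -[leLHS]sqrtr1 ler_wsqrtr// -[leLHS]sqrtr1 ler_wsqrtr// ler1n.
have xy : x <= y by rewrite !ler_wsqrtr// ler_nat.
have e : (y - x) * (y ^+ 3 + y ^+ 2 * x + y * x ^+ 2 + x ^+ 3) = 1.
  by transitivity (y ^+ 4 - x ^+ 4); [ring|rewrite x4 y4; ring].
have b1 : y ^+ 2 * x <= y ^+ 4 by rewrite -[4%N]/(2 + 2)%N exprD ler_wpM2l ?sqr_ge0//; nra.
have b2 : y * x ^+ 2 <= y ^+ 4.
  have h : x ^+ 2 <= y ^+ 2 by rewrite lerXn2r ?nnegrE//; lra.
  have h1 : y * x ^+ 2 <= y * y ^+ 2 by rewrite ler_wpM2l//; lra.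
  by have := ler_weXn2l y1 (isT : (3 <= 4)%N); rewrite exprS; lra.
have b3 : x ^+ 3 <= y ^+ 4.
  have h : x ^+ 3 <= y ^+ 3 by rewrite lerXn2r ?nnegrE//; lra.
  by have := ler_weXn2l y1 (isT : (3 <= 4)%N); lra.
have b0 : y ^+ 3 <= y ^+ 4 by exact: ler_weXn2l.
have h : (y - x) * (y ^+ 3 + y ^+ 2 * x + y * x ^+ 2 + x ^+ 3)
    <= (y - x) * (4 * y ^+ 4) by rewrite ler_wpM2l ?subr_ge0//; lra.
have yi : k.+1%:R^-1 <= 4 * (y - x).
  have yp : 0 < y ^+ 4 by rewrite exprn_gt0//; lra.
  by rewrite -natr1 -y4 -[X in X <= _]mul1r ler_pdivrMr//; lra.
by apply: le_trans (lerD IH yi) _; lra.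
Qed.

End sum_bounds.

(** * Mean and variance of an abstract Bernoulli autoregression *)

Section bernoulli_chain.
Context {R : realType}.

(* A time-inhomogeneous real chain which, at step [k] and from position [y], moves
   by [q - 1] with probability [a k * (y + c k)] and by [q] otherwise; [L k f] is
   the expectation of [f] at time [k]. *)
Record is_bernoulli_chain (L : nat -> (R -> R) -> R) (a c : nat -> R) (q y0 : R)
    : Prop := {
  chain_lin : forall k (s : R) (f g : R -> R),
    L k (fun y => s * f y + g y) = s * L k f + L k g ;
  chain_mono : forall k (f g : R -> R),
    (forall y, 0 <= a k * (y + c k) <= 1 -> f y <= g y) -> L k f <= L k g ;
  chain_init : forall f : R -> R, L 0%N f = f y0 ;
  chain_step : forall k (f : R -> R), L k.+1 f =
    L k (fun y => (1 - a k * (y + c k)) * f (y + q)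
                  + a k * (y + c k) * f (y + q - 1)) }.

Context (L : nat -> (R -> R) -> R) (a c : nat -> R) (q y0 : R).
Hypothesis HL : is_bernoulli_chain L a c q y0.

Lemma chain_cst k (s : R) : L k (fun=> s) = s.
Proof.
elim: k s => [|k IH] s; first exact: (chain_init _ _ _ _ _ HL).
rewrite (chain_step _ _ _ _ _ HL) -[RHS]IH; congr (L k _); apply/funext => y; ring.
Qed.

Lemma chainD k (f g : R -> R) : L k (fun y => f y + g y) = L k f + L k g.
Proof.
rewrite -[L k f]mul1r -(chain_lin _ _ _ _ _ HL); congr (L k _).
by apply/funext => y; rewrite mul1r.
Qed.

Lemma chainZ k (s : R) (f : R -> R) : L k (fun y => s * f y) = s * L k f.
Proof.
have := chain_lin _ _ _ _ _ HL k s f (fun=> 0).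
by rewrite chain_cst addr0 => <-; congr (L k _); apply/funext => y; rewrite addr0.
Qed.

Lemma chain_le k (f g : R -> R) : (forall y, f y <= g y) -> L k f <= L k g.
Proof. by move=> fg; apply: (chain_mono _ _ _ _ _ HL) => y _. Qed.

Lemma chain_ext k (f g : R -> R) : f =1 g -> L k f = L k g.
Proof. by move=> fg; congr (L k _); apply/funext. Qed.

(** The comparison is asked only at states where the jump probability is a genuine probability; this
    plays the part of the support of the law at time [k]. *)
Lemma chain_normB_le k (f g h : R -> R) :
  (forall y, 0 <= a k * (y + c k) <= 1 -> `|f y - g y| <= h y) ->
  `|L k f - L k g| <= L k h.
Proof.
move=> H.
have e1 := chainD k g h; have e2 := chainD k f h.
rewrite ler_norml; apply/andP; split.
- have : L k g <= L k (fun y => f y + h y).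
    by apply: (chain_mono _ _ _ _ _ HL) => y /H; rewrite ler_norml; lra.
  by rewrite e2; lra.
- have : L k f <= L k (fun y => g y + h y).
    by apply: (chain_mono _ _ _ _ _ HL) => y /H; rewrite ler_norml; lra.
  by rewrite e1; lra.
Qed.

Fixpoint chain_mean k : R :=
  if k is j.+1 then (1 - a j) * chain_mean j + (q - a j * c j) else y0.

Hypothesis a01 : forall k, 0 <= a k <= 1.

(** Given the state, the next one deviates from its mean by [(1 - a k)] times the old deviation plus
    noise of variance [r (1 - r) <= 1/4], with [r] the jump probability. Hence
    [V' <= (1 - a k)^2 V + 1/4], for any rates in [[0, 1]]. *)
Lemma chain_variance_le k :
  L k (fun y => (y - chain_mean k) ^+ 2) <= k%:R / 4.
Proof.
have centered j : L j (fun y => y - chain_mean j) = 0.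
  elim: j => [|j IH]; first by rewrite (chain_init _ _ _ _ _ HL)/= subrr.
  rewrite (chain_step _ _ _ _ _ HL) /= -[RHS](mulr0 (1 - a j)) -IH -chainZ.
  by apply: chain_ext => y; ring.
elim: k => [|k IH]; first by rewrite (chain_init _ _ _ _ _ HL)/= subrr expr0n mul0r.
rewrite (chain_step _ _ _ _ _ HL) /=.
set mu := chain_mean k in IH *.
have : L k (fun y => (1 - a k) ^+ 2 * (y - mu) ^+ 2
    + a k * (y + c k) * (1 - a k * (y + c k))) <= (1 - a k) ^+ 2 * (k%:R / 4) + 1 / 4.
  rewrite chainD chainZ lerD//; first by rewrite ler_wpM2l// sqr_ge0.
  rewrite -[leRHS](chain_cst k); apply: (chain_mono _ _ _ _ _ HL) => y.
  set r := a k * _ => _; have := sqr_ge0 (r - 1 / 2); lra.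
set f := (X in L k X <= _ * _ + _).
rewrite (_ : L k _ = L k f); last by apply: chain_ext => y; rewrite /f; ring.
have /andP[ak0 ak1] := a01 k; have k0 : 0 <= (k%:R : R) by [].
have b : (1 - a k) ^+ 2 * (k%:R / 4) <= k%:R / 4.
  by rewrite ler_piMl ?divr_ge0// expr_le1//; lra.
by move/le_trans; apply; apply: (le_trans (lerD b (lexx _))); rewrite -natr1; lra.
Qed.

Lemma chain_chebyshev k (s : R) : 0 < s ->
  L k (fun y => (s <= `|y - chain_mean k|)%R%:R) <= k%:R / (4 * s ^+ 2).
Proof.
move=> s0; have s20 : 0 < s ^+ 2 by rewrite exprn_gt0.
apply: (@le_trans _ _ (L k (fun y => (s ^+ 2)^-1 * (y - chain_mean k) ^+ 2))).
  apply: chain_le => y; case: (leP s) => [h|_]; last first.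
    by rewrite mulr0n mulr_ge0 ?invr_ge0 ?sqr_ge0.
  rewrite mulr1n mulrC ler_pdivlMr// mul1r -(real_normK (num_real (_ - _))).
  by rewrite lerXn2r ?nnegrE//; lra.
have -> : k%:R / (4 * s ^+ 2) = (s ^+ 2)^-1 * (k%:R / 4).
  by field; rewrite gt_eqF.
by rewrite chainZ ler_wpM2l ?invr_ge0 ?(ltW s20)// chain_variance_le.
Qed.

Lemma chain_mean_drift (C : R) k l : (k <= l)%N ->
  (forall j, (k <= j < l)%N -> `|q - a j * c j| <= C / j.+1%:R) ->
  `|chain_mean l| <= `|chain_mean k| + C * \sum_(k <= j < l) j.+1%:R^-1.
Proof.
elim: l => [|l IH] kl hC.
  by move: kl; rewrite leqn0 => /eqP ->; rewrite big_geq// mulr0 addr0.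
move: kl; rewrite leq_eqVlt => /predU1P[->|kl].
  by rewrite big_geq// mulr0 addr0.
rewrite big_nat_recr//= mulrDr [leRHS]addrA (le_trans (ler_normD _ _))// lerD//; last first.
  by apply: hC; rewrite -ltnS kl ltnSn.
rewrite normrM (le_trans _ (IH _ _))//; last first.
  by move=> j /andP[kj jl]; apply: hC; rewrite kj ltnS ltnW.
have /andP[? ?] := a01 l.
by rewrite ler_piMl// ger0_norm; lra.
Qed.

End bernoulli_chain.

(** * One step of the Lindeberg replacement *)

Section lindeberg_step.
Context {R : realType}.
Implicit Types (r rho e h H b A y s t : R).

(** To first order [Phi (r / sqrt (1 + e))] subtracts [e / 2 * (r * gauss r)], exactly what a
    centred step of second moment [e] does to [Phi r]. What is left is the mean of the step, the
    mismatch of its second moment with [e], and Taylor remainders. *)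
Lemma two_point_expansion r rho h0 h1 e H :
  0 <= rho <= 1 -> `|h0| <= H -> `|h1| <= H -> `|e| <= 1 / 2 ->
  `|(1 - rho) * Phi (r + h0) + rho * Phi (r + h1) - Phi (r / Num.sqrt (1 + e))|
  <= 32 * `|(1 - rho) * h0 + rho * h1|
     + 16 * `|(1 - rho) * h0 ^+ 2 + rho * h1 ^+ 2 - e| + 32 * H ^+ 3
     + 128 * e ^+ 2.
Proof.
move=> /andP[r0 r1] hh0 hh1 he.
have T0 := Phi_taylor2 r h0; have T1 := Phi_taylor2 r h1.
have Te := Phi_variance_taylor1 r e he.
set R0 := (X in `|X| <= _) in T0; set R1 := (X in `|X| <= _) in T1.
set Re := (X in `|X| <= _) in Te.
set m1 := (1 - rho) * h0 + rho * h1.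
set m2 := (1 - rho) * h0 ^+ 2 + rho * h1 ^+ 2 - e.
have -> : (1 - rho) * Phi (r + h0) + rho * Phi (r + h1)
    - Phi (r / Num.sqrt (1 + e)) =
  m1 * gauss r - m2 / 2 * (r * gauss r) + ((1 - rho) * R0 + rho * R1) - Re.
  by rewrite /R0 /R1 /Re /m1 /m2; field.
have H3 h : `|h| <= H -> 32 * `|h| ^+ 3 <= 32 * H ^+ 3.
  by move=> hH; rewrite ler_wpM2l// lerXn2r ?nnegrE// (le_trans _ hH).
have g1 : `|gauss r| <= 32.
  rewrite -[gauss r]mul1r; apply: norm_mul_gauss_le.
  rewrite normr1 (_ : r ^+ 4 = (r ^+ 2) ^+ 2); last by rewrite -exprM.
  by have := sqr_ge0 (r ^+ 2); nra.
have g2 : `|r * gauss r| <= 32.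
  apply: norm_mul_gauss_le; rewrite ler_norml.
  have := sqr_ge0 (r - 1); have := sqr_ge0 (r + 1); have := sqr_ge0 (r ^+ 2 - 1).
  by move=> *; apply/andP; split; nra.
have b1 : `|m1 * gauss r| <= 32 * `|m1|.
  by rewrite normrM mulrC ler_wpM2r.
have b2 : `|m2 / 2 * (r * gauss r)| <= 16 * `|m2|.
  have := ler_wpM2l (normr_ge0 m2) g2.
  move=> h; rewrite normrM [`|m2 / 2|]normrM normfV (ger0_norm (ler0n _ 2)).
  by rewrite mulrAC; lra.
have b3 : `|(1 - rho) * R0 + rho * R1| <= 32 * H ^+ 3.
  have k0 := le_trans T0 (H3 _ hh0); have k1 := le_trans T1 (H3 _ hh1).
  rewrite (le_trans (ler_normD _ _))// !normrM (ger0_norm r0) ger0_norm ?subr_ge0//.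
  have := ler_wpM2l r0 k1; have := ler_wpM2l (_ : 0 <= 1 - rho) k0.
  by move=> /(_ ltac:(lra)); lra.
rewrite (le_trans (ler_normB _ _))// lerD// (le_trans (ler_normD _ _))// lerD//.
by rewrite (le_trans (ler_normB _ _))// lerD.
Qed.

Context (a c q theta w C t k y A s b : R).

(** Here [s = 1 / sqrt V] after the step, [t] stands for [1 / (k + 1)], and [e] is such that
    [V (1 + e)] is the variance before the step, where [A] becomes [A (1 - a)]. As [a * k] is close
    to [theta], [e] is close to [A^2 w (1 + 2 theta) s^2 = A^2 q (1 - q) s^2], the second moment of
    one scaled step. *)
Lemma lindeberg_step :
  let rho := a * (y + c) in
  let e := A ^+ 2 * w * (1 + 2 * (a * k) - a * (a * k)) * s ^+ 2 in
  let E := w * (1 + 3 * (theta + C)) in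
  0 <= rho <= 1 -> 0 <= q <= 1 -> 0 <= A <= 1 -> 0 < s -> 0 <= theta ->
  0 <= w -> q * (1 - q) = w * (1 + 2 * theta) ->
  0 <= t <= 1 -> 1 <= C -> 0 <= k -> 0 <= a <= 1 -> a <= C * t ->
  `|q - a * c| <= C * t -> `|a * k - theta| <= C * t ->
  E * s ^+ 2 <= 1 / 2 ->
  `|(1 - rho) * Phi ((b - A * (y + q)) * s) + rho * Phi ((b - A * (y + q - 1)) * s)
    - Phi ((b - A * (1 - a) * y) * s / Num.sqrt (1 + e))|
  <= 32 * C * (t * s)
     + 16 * (C * (1 + C + w * (2 + theta + C))) * (t * (`|y| + 1) * s ^+ 2)
     + 32 * (4 + C) ^+ 3 * s ^+ 3 + 128 * E ^+ 2 * s ^+ 4.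
Proof.
move=> rho e E r01 /andP[q0 q1] /andP[A0 A1] s0 th0 w0 qw /andP[t0 t1] C1 k0.
move=> /andP[a0 a1] aC qac akth Es.
have /andP[r0 r1] := r01.
have ak0 : 0 <= a * k by exact: mulr_ge0.
have Ct : C * t <= C by rewrite ler_piMr//; lra.
have akC : a * k <= theta + C by move: akth; rewrite ler_norml; lra.
have A2 : A ^+ 2 <= 1 by rewrite expr_le1.
have A20 : 0 <= A ^+ 2 by exact: sqr_ge0.
have aak : a * (a * k) <= a * k by rewrite ler_piMl.
have aak0 : 0 <= a * (a * k) by rewrite mulr_ge0.
have s20 : 0 <= s ^+ 2 by exact: sqr_ge0.
have E0 : 0 <= E by rewrite mulr_ge0//; lra.
have e0 : 0 <= e.
  rewrite /e; apply: mulr_ge0 => //; apply: mulr_ge0; last by lra.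
  exact: mulr_ge0.
have eE : e <= E * s ^+ 2.
  rewrite /e ler_wpM2r// /E -mulrA.
  apply: (@le_trans _ _ (w * (1 + 2 * (a * k) - a * (a * k)))).
    by rewrite ler_piMl// mulr_ge0//; lra.
  by rewrite ler_wpM2l//; lra.
have e12 : `|e| <= 1 / 2 by rewrite ger0_norm//; lra.
(* Increments relative to the contracted state [(1 - a) y]. They are bounded although [y] need not
   be, because [a * y = rho - a * c] with [rho] in [[0, 1]]. *)
pose d0 := - (q + a * y); pose d1 := 1 - q - a * y.
have ayE : a * y = rho - a * c by rewrite /rho; ring.
have d0C : `|d0| <= 4 + C.
  by move: qac; rewrite /d0 ayE !ler_norml; lra.
have d1C : `|d1| <= 4 + C.
  by move: qac; rewrite /d1 ayE !ler_norml; lra.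
have sc d : `|d| <= 4 + C -> `|A * d * s| <= (4 + C) * s.
  move=> dC; rewrite normrM (ger0_norm (ltW s0)) ler_wpM2r ?(ltW s0)//.
  by rewrite normrM (ger0_norm A0) (le_trans _ dC)// ler_piMl.
have := two_point_expansion ((b - A * (1 - a) * y) * s) rho (A * d0 * s)
  (A * d1 * s) e ((4 + C) * s) r01 (sc _ d0C) (sc _ d1C) e12.
have -> : (b - A * (1 - a) * y) * s + A * d0 * s = (b - A * (y + q)) * s.
  by rewrite /d0; ring.
have -> : (b - A * (1 - a) * y) * s + A * d1 * s = (b - A * (y + q - 1)) * s.
  by rewrite /d1; ring.
move/le_trans; apply.
have -> : (1 - rho) * (A * d0 * s) + rho * (A * d1 * s) = A * (a * c - q) * s.
  by rewrite /d0 /d1 /rho; ring.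
(* The leading parts [q (1 - q)] and [w (1 + 2 theta)] cancel; every remaining summand is
   [O(t (|y| + 1))]. *)
have -> : (1 - rho) * (A * d0 * s) ^+ 2 + rho * (A * d1 * s) ^+ 2 - e =
   A ^+ 2 * (rho * (1 - rho) - q * (1 - q) + (a * c - q) ^+ 2
     + w * (2 * (theta - a * k) + a * (a * k))) * s ^+ 2.
  by rewrite qw /e /d0 /d1 /rho; ring.
have b1 : `|A * (a * c - q) * s| <= C * (t * s).
  rewrite normrM (ger0_norm (ltW s0)) mulrA ler_wpM2r ?(ltW s0)//.
  by rewrite normrM (ger0_norm A0) distrC (le_trans _ qac)// ler_piMl.
have y1 : 0 <= `|y| by [].
have yt : C * t <= C * t * (`|y| + 1).
  by rewrite ler_peMr ?mulr_ge0//; lra.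
have Ct0 : 0 <= C * t by rewrite mulr_ge0//; lra.
have rq : `|rho * (1 - rho) - q * (1 - q)| <= C * t * (`|y| + 1).
  rewrite (_ : _ - _ = (rho - q) * (1 - rho - q)); last by ring.
  rewrite normrM (@le_trans _ _ (`|rho - q| * 1))//.
    by rewrite ler_wpM2l// ler_norml; lra.
  rewrite mulr1 (_ : rho - q = a * y + - (q - a * c)); last by rewrite /rho; ring.
  rewrite (le_trans (ler_normD _ _))// normrN mulrDr mulr1 lerD//.
  by rewrite normrM (ger0_norm a0) ler_wpM2r.
have qac2 : `|(a * c - q) ^+ 2| <= C * (C * t * (`|y| + 1)).
  rewrite normrX distrC expr2 ler_pM//; first exact: le_trans qac Ct.
  exact: le_trans qac yt.
have wth : `|w * (2 * (theta - a * k) + a * (a * k))|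
    <= w * (2 + theta + C) * (C * t * (`|y| + 1)).
  rewrite normrM (ger0_norm w0) -mulrA ler_wpM2l// (le_trans (ler_normD _ _))//.
  rewrite normrM ger0_norm// distrC (ger0_norm aak0).
  have : a * (a * k) <= C * t * (theta + C) by rewrite ler_pM.
  have : (theta + C) * (C * t) <= (theta + C) * (C * t * (`|y| + 1)).
    by rewrite ler_wpM2l//; lra.
  by lra.
have b2 : `|A ^+ 2 * (rho * (1 - rho) - q * (1 - q) + (a * c - q) ^+ 2
     + w * (2 * (theta - a * k) + a * (a * k))) * s ^+ 2| <=
   (C * (1 + C + w * (2 + theta + C))) * (t * (`|y| + 1) * s ^+ 2).
  rewrite normrM (ger0_norm s20) [leRHS]mulrA ler_wpM2r//.
  rewrite normrM (ger0_norm A20) (@le_trans _ _ (1 * (C * t * (`|y| + 1)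
    + C * (C * t * (`|y| + 1)) + w * (2 + theta + C) * (C * t * (`|y| + 1)))))//.
    rewrite ler_pM// (le_trans (ler_normD _ _))// lerD//.
    by rewrite (le_trans (ler_normD _ _))// lerD.
  by rewrite le_eqVlt; apply/orP; left; apply/eqP; ring.
have b4 : e ^+ 2 <= E ^+ 2 * s ^+ 4.
  rewrite -[4%N]/(2 * 2)%N exprM -exprMn lerXn2r ?nnegrE//.
  exact: le_trans eE.
have -> : ((4 + C) * s) ^+ 3 = (4 + C) ^+ 3 * s ^+ 3 by ring.
apply: lerD; last by rewrite -[leRHS]mulrA ler_wpM2l.
apply: lerD; last by rewrite mulrA.
by apply: lerD; rewrite -[leRHS]mulrA ler_wpM2l.
Qed.

End lindeberg_step.

(** * Gaussian approximation of the smoothed chain *)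

Section chain_clt.
Context {R : realType} (L : nat -> (R -> R) -> R) (a c : nat -> R) (q y0 : R).
Hypothesis HL : is_bernoulli_chain L a c q y0.
Context (theta w C : R).
Hypothesis a01 : forall k, 0 <= a k <= 1.
Hypothesis q01 : 0 <= q <= 1.
Hypothesis theta0 : 0 <= theta.
Hypothesis w0 : 0 <= w.
Hypothesis qw : q * (1 - q) = w * (1 + 2 * theta).
Hypothesis C1 : 1 <= C.
Hypothesis aC : forall k, a k <= C / k.+1%:R.
Hypothesis acC : forall k, `|q - a k * c k| <= C / k.+1%:R.
Hypothesis akC : forall k, `|a k * k%:R - theta| <= C / k.+1%:R.

Lemma inv_le_invsqrt k : (k.+1%:R : R)^-1 <= (Num.sqrt k.+1%:R)^-1.
Proof.
have h : 1 <= (k.+1%:R : R) by rewrite ler1n.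
have s1 : 1 <= Num.sqrt (k.+1%:R : R) by rewrite -[leLHS]sqrtr1 ler_wsqrtr.
rewrite lef_pV2 ?posrE ?sqrtr_gt0//.
by rewrite -[leRHS](@sqr_sqrtr _ (k.+1%:R)) ?ler_eXnr//; lra.
Qed.

Lemma chain_mean_le k :
  `|chain_mean a c q y0 k| <= `|y0| + C * \sum_(j < k) (j.+1%:R)^-1.
Proof.
rewrite -(big_mkord xpredT (fun j => (j.+1%:R : R)^-1)).
by apply: chain_mean_drift (leq0n k) _ => // j _.
Qed.

Lemma chain_abs_le k :
  L k (fun y => `|y|) <= (1 + `|y0| + 2 * C) * Num.sqrt k.+1%:R.
Proof.
have C1' := C1; set s := Num.sqrt _; set mu := chain_mean a c q y0 k.
have s2 : s ^+ 2 = k%:R + 1 by rewrite sqr_sqrtr// -natr1.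
have s1 : 1 <= s by rewrite -[leLHS]sqrtr1 ler_wsqrtr// ler1n.
have muC : `|mu| <= `|y0| + C * (2 * s).
  apply: (le_trans (chain_mean_le k)); rewrite lerD2l ler_wpM2l ?(le_trans ler01 C1)//.
  apply: le_trans (_ : 2 * Num.sqrt k%:R <= _).
    by apply: le_trans (sum_invsqrt_le k); apply: ler_sum => j _; exact: inv_le_invsqrt.
  by rewrite ler_wpM2l// ler_wsqrtr// ler_nat.
have := chain_variance_le _ _ _ _ _ HL a01 k; rewrite -/mu => V.
(* In place of Cauchy-Schwarz for [L]: the pointwise inequality [|z| <= z^2 / (2 s) + s / 2] at the
   scale [s = sqrt (k + 1)]. *)
apply: (@le_trans _ _ (L k (fun y => (2 * s)^-1 * (y - mu) ^+ 2 + (s / 2 + `|mu|)))).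
  apply: (chain_le _ _ _ _ _ HL) => y.
  have h : `|y| <= `|y - mu| + `|mu| by rewrite -{1}(subrK mu y) ler_normD.
  have h2 : `|y - mu| <= (2 * s)^-1 * (y - mu) ^+ 2 + s / 2.
    rewrite -(real_normK (num_real (y - mu))); set z := `|_|.
    have z0 : 0 <= z by exact: normr_ge0.
    rewrite -subr_ge0 (_ : _ - _ = (2 * s)^-1 * (z - s) ^+ 2).
      by rewrite mulr_ge0 ?sqr_ge0// invr_ge0; lra.
    by field; rewrite gt_eqF//; lra.
  by lra.
rewrite (chainD _ _ _ _ _ HL) (chainZ _ _ _ _ _ HL) (chain_cst _ _ _ _ _ HL).
have b : (2 * s)^-1 * L k (fun y => (y - mu) ^+ 2) <= s / 8.
  apply: (@le_trans _ _ ((2 * s)^-1 * (s ^+ 2 / 4))).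
    apply: ler_wpM2l; first by rewrite invr_ge0; lra.
    by apply: le_trans V _; lra.
  by rewrite le_eqVlt; apply/orP; left; apply/eqP; field; rewrite gt_eqF//; lra.
have := normr_ge0 y0; nra.
Qed.

(** The factor by which a deviation at time [k] has shrunk, in conditional mean, at the horizon
    [K]. *)
Definition backward_prod K k : R := \prod_(k <= j < K) (1 - a j).

Lemma backward_prodS K k : (k < K)%N ->
  backward_prod K k = (1 - a k) * backward_prod K k.+1.
Proof. by move=> kK; rewrite /backward_prod big_ltn. Qed.

Lemma backward_prod01 K k : 0 <= backward_prod K k <= 1.
Proof.
rewrite /backward_prod; elim/big_ind: _ => [|x y /andP[? ?] /andP[? ?]|j _].
- by rewrite ler01 lexx.
- by rewrite mulr_ge0//= mulr_ile1.
- by have := a01 j; lra.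
Qed.

(** Smoothing variance plus the noise injected between [k] and [K]: of the total [w K], the share
    inherited from time [k] is [w k] times the squared contraction. The value is [v] at [k = K] and
    [v + w K] at [k = 0]. *)
Definition remaining_variance (v : R) K k : R :=
  v + w * (K%:R - backward_prod K k ^+ 2 * k%:R).

Lemma remaining_variance_ge v K k : (k <= K)%N -> v <= remaining_variance v K k.
Proof.
move=> kK; rewrite /remaining_variance lerDl mulr_ge0// subr_ge0.
have /andP[A0 A1] := backward_prod01 K k.
apply: (@le_trans _ _ k%:R); last by rewrite ler_nat.
by rewrite ler_piMl// expr_le1.
Qed.

Let E := w * (1 + 3 * (theta + C)).
Let K2 := 16 * (C * (1 + C + w * (2 + theta + C))).
Let D := 1 + `|y0| + 2 * C.

Lemma chain_step_error (v b : R) K k : (k < K)%N -> 0 < v ->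
  let s := (Num.sqrt v)^-1 in
  let F j y := Phi ((b - backward_prod K j * y) / Num.sqrt (remaining_variance v K j)) in
  E * s ^+ 2 <= 1 / 2 ->
  `|L k.+1 (F k.+1) - L k (F k)| <=
    32 * C * s * k.+1%:R^-1 + K2 * (D + 1) * s ^+ 2 * (Num.sqrt k.+1%:R)^-1
    + (32 * (4 + C) ^+ 3 * s ^+ 3 + 128 * E ^+ 2 * s ^+ 4).
Proof.
have C1' := C1; have theta0' := theta0; have w0' := w0; move=> kK v0 s F Es.
pose t : R := k.+1%:R^-1.
have t01 : 0 <= t <= 1 by rewrite /t invr_ge0 ler0n/= invf_le1 ?ltr0n// ler1n.
have t0 : 0 <= t by have := t01; lra.
have vV := remaining_variance_ge v K _ kK.
set V := remaining_variance v K k.+1 in vV.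
have V0 : 0 < V by exact: lt_le_trans vV.
pose u := (Num.sqrt V)^-1.
have u0 : 0 < u by rewrite invr_gt0 sqrtr_gt0.
have s0 : 0 < s by rewrite invr_gt0 sqrtr_gt0.
have us : u <= s by rewrite lef_pV2 ?posrE ?sqrtr_gt0// ler_wsqrtr.
have us2 n : u ^+ n <= s ^+ n by rewrite lerXn2r ?nnegrE ?(ltW u0) ?(ltW s0).
have C0 : 0 <= C by lra.
have E0 : 0 <= E by rewrite mulr_ge0//; lra.
have K20 : 0 <= K2 by rewrite !mulr_ge0// !addr_ge0// mulr_ge0//; lra.
have Eu : E * u ^+ 2 <= 1 / 2 by rewrite (le_trans _ Es)// ler_wpM2l.
rewrite (chain_step _ _ _ _ _ HL).
pose h (y : R) := 32 * C * (t * s) + K2 * (t * (`|y| + 1) * s ^+ 2)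
  + 32 * (4 + C) ^+ 3 * s ^+ 3 + 128 * E ^+ 2 * s ^+ 4.
apply: (@le_trans _ _ (L k h)).
  apply: (chain_normB_le _ _ _ _ _ HL) => y rho01.
  have := lindeberg_step (a k) (c k) q theta w C t k%:R y (backward_prod K k.+1) u b
    rho01 q01 (backward_prod01 _ _) u0 theta0 w0 qw t01 C1 (ler0n _ _) (a01 k)
    (aC k) (acC k) (akC k) Eu.
  set e := (X in Num.sqrt (1 + X)).
  have -> : (b - backward_prod K k.+1 * (1 - a k) * y) * u / Num.sqrt (1 + e) =
      (b - backward_prod K k * y) / Num.sqrt (remaining_variance v K k).
    rewrite (backward_prodS K k kK) (mulrC (1 - a k)) -[LHS]mulrA -invfM; congr (_ * _^-1).
    have -> : remaining_variance v K k = V * (1 + e).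
      have uV : u ^+ 2 * V = 1.
        by rewrite /u exprVn sqr_sqrtr ?(ltW V0)// mulVf// gt_eqF.
      rewrite (_ : V * (1 + e) = V + backward_prod K k.+1 ^+ 2 * w *
        (1 + 2 * (a k * k%:R) - a k * (a k * k%:R)) * (u ^+ 2 * V)); last first.
        by rewrite /e; ring.
      rewrite uV mulr1 /V /remaining_variance.
      by rewrite backward_prodS// -natr1; ring.
    by rewrite sqrtrM// ltW.
  move/le_trans; apply; rewrite /h.
  have y1 : 0 <= `|y| + 1 by rewrite addr_ge0.
  apply: lerD; last by rewrite ler_wpM2l// mulr_ge0// sqr_ge0.
  apply: lerD; last by rewrite ler_wpM2l// mulr_ge0// exprn_ge0// addr_ge0.
  apply: lerD; first by rewrite ler_wpM2l ?mulr_ge0// ler_wpM2l.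
  by rewrite ler_wpM2l// ler_wpM2l// mulr_ge0.
have hE : h = fun y => (K2 * (t * s ^+ 2)) * `|y| +
    (32 * C * (t * s) + K2 * (t * s ^+ 2) + 32 * (4 + C) ^+ 3 * s ^+ 3
     + 128 * E ^+ 2 * s ^+ 4).
  by apply/funext => y; rewrite /h; ring.
rewrite hE (chain_lin _ _ _ _ _ HL) (chain_cst _ _ _ _ _ HL).
set r := Num.sqrt k.+1%:R.
have r0 : 0 < r by rewrite sqrtr_gt0 ltr0n.
(* Averaging [|y|] costs [sqrt (k + 1)], which weakens [t = 1 / (k + 1)] to [1 / sqrt (k + 1)]. *)
have tr : t * r = r^-1.
  have r2 : t = (r ^+ 2)^-1 by rewrite /t /r sqr_sqrtr.
  by rewrite r2; field; rewrite gt_eqF.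
have tr' : t <= r^-1 by exact: inv_le_invsqrt.
have abs := chain_abs_le k.
have T1 : K2 * (t * s ^+ 2) * L k (fun y => `|y|) <= K2 * D * s ^+ 2 * r^-1.
  apply: (@le_trans _ _ (K2 * (t * s ^+ 2) * (D * r))).
    by rewrite ler_wpM2l// mulr_ge0// mulr_ge0// sqr_ge0.
  by rewrite -tr le_eqVlt; apply/orP; left; apply/eqP; ring.
have T2 : K2 * (t * s ^+ 2) <= K2 * s ^+ 2 * r^-1.
  by rewrite mulrCA mulrC ler_wpM2l// mulr_ge0// sqr_ge0.
rewrite -/t; lra.
Qed.

(** The one-step errors are telescoped: at time [K] the function is a smoothed half-line, at time 0
    the chain sits at [y0] and its value is a single normal probability. [M] is independent of [K],
    [v] and [b], so that [v] may grow with [K]. *)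
Lemma chain_gaussian_approx :
  exists M : R, forall (K : nat) (v b : R), 0 < v ->
    let s := (Num.sqrt v)^-1 in s <= 1 -> E * s ^+ 2 <= 1 / 2 ->
    `|L K (fun y => Phi ((b - y) / Num.sqrt v))
      - Phi ((b - backward_prod K 0 * y0) / Num.sqrt (v + w * K%:R))|
    <= M * (s * Num.sqrt (Num.sqrt K%:R) + s ^+ 2 * Num.sqrt K%:R + s ^+ 3 * K%:R).
Proof.
(* The factors 4 in [128 = 32 * 4] and 2 come from the two sum bounds; the last bracket uses
   [s^4 <= s^3]. *)
pose M := 128 * C + 2 * (K2 * (D + 1)) + (32 * (4 + C) ^+ 3 + 128 * E ^+ 2).
exists M => K v b v0 s s1 Es.
pose F j y := Phi ((b - backward_prod K j * y) / Num.sqrt (remaining_variance v K j)).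
have -> : (fun y => Phi ((b - y) / Num.sqrt v)) = F K.
  apply/funext => y; rewrite /F /remaining_variance /backward_prod big_geq//.
  by rewrite expr1n !mul1r subrr mulr0 addr0.
have -> : Phi ((b - backward_prod K 0 * y0) / Num.sqrt (v + w * K%:R)) = L 0%N (F 0%N).
  by rewrite (chain_init _ _ _ _ _ HL) /F /remaining_variance mulr0 subr0.
have tele : L K (F K) - L 0%N (F 0%N) =
    \sum_(k < K) (L k.+1 (F k.+1) - L k (F k)).
  by rewrite -(big_mkord xpredT (fun k => L k.+1 (F k.+1) - L k (F k))) telescope_sumr.
rewrite tele (le_trans (ler_norm_sum _ _ _))//.
apply: le_trans (ler_sum _ (fun (k : 'I_K) _ =>
  chain_step_error v b K k (ltn_ord k) v0 Es)) _.
rewrite big_split big_split/= -!mulr_sumr sumr_const card_ord -/s -[_ *+ K]mulr_natr.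
have C0 : 0 <= C by exact: le_trans C1.
have theta0' := theta0; have w0' := w0.
have E0 : 0 <= E by rewrite mulr_ge0//; lra.
have K20 : 0 <= K2 by rewrite !mulr_ge0// !addr_ge0// mulr_ge0//; lra.
have s0 : 0 <= s by rewrite invr_ge0 sqrtr_ge0.
have D0 : 0 <= D + 1 by rewrite /D; have := normr_ge0 y0; lra.
have S1 := sum_inv_le (R := R) K; have S2 := sum_invsqrt_le (R := R) K.
set P := s * Num.sqrt (Num.sqrt K%:R); set Q := s ^+ 2 * Num.sqrt K%:R.
set T := s ^+ 3 * K%:R.
have P0 : 0 <= P by rewrite mulr_ge0// sqrtr_ge0.
have Q0 : 0 <= Q by rewrite mulr_ge0 ?sqrtr_ge0// sqr_ge0.
have T0 : 0 <= T by rewrite mulr_ge0// exprn_ge0.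
pose x := 128 * C; pose y := 2 * (K2 * (D + 1)).
pose z := 32 * (4 + C) ^+ 3 + 128 * E ^+ 2.
have x0 : 0 <= x by rewrite /x; lra.
have y'0 : 0 <= y by apply: mulr_ge0 => //; exact: mulr_ge0.
have z0 : 0 <= z by rewrite addr_ge0// mulr_ge0 ?sqr_ge0// exprn_ge0// addr_ge0.
have I1 : 32 * C * s * \sum_(i < K) i.+1%:R^-1 <= x * P.
  apply: (@le_trans _ _ (32 * C * s * (4 * Num.sqrt (Num.sqrt K%:R)))).
    by rewrite ler_wpM2l// !mulr_ge0.
  by rewrite le_eqVlt; apply/orP; left; apply/eqP; rewrite /x /P; ring.
have I2 : K2 * (D + 1) * s ^+ 2 * \sum_(i < K) (Num.sqrt i.+1%:R)^-1 <= y * Q.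
  apply: (@le_trans _ _ (K2 * (D + 1) * s ^+ 2 * (2 * Num.sqrt K%:R))).
    by apply: ler_wpM2l => //; apply: mulr_ge0; [exact: mulr_ge0|exact: sqr_ge0].
  by rewrite le_eqVlt; apply/orP; left; apply/eqP; rewrite /y /Q; ring.
have I3 : (32 * (4 + C) ^+ 3 * s ^+ 3 + 128 * E ^+ 2 * s ^+ 4) * K%:R <= z * T.
  rewrite /T [leRHS]mulrA; apply: ler_wpM2r => //.
  rewrite /z [leRHS]mulrDl; apply: lerD => //; apply: ler_wpM2l.
    by rewrite mulr_ge0 ?sqr_ge0.
  exact: ler_wiXn2l.
have xQ := mulr_ge0 x0 Q0; have xT := mulr_ge0 x0 T0.
have yP := mulr_ge0 y'0 P0; have yT := mulr_ge0 y'0 T0.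
have zP := mulr_ge0 z0 P0; have zQ := mulr_ge0 z0 Q0.
apply: le_trans (lerD (lerD I1 I2) I3) _.
have -> : M = x + y + z by rewrite /M /x /y /z.
by lra.
Qed.

End chain_clt.

(** * From the smoothed to the sharp central limit theorem *)

Section chain_cdf.
Context {R : realType} (L : nat -> (R -> R) -> R) (a c : nat -> R) (q y0 : R).
Context (theta W C : R) (m : nat).

(** [W] is the variance per vertex; a vertex takes [m] steps, so the variance per step is
    [W / m]. *)
Record clt_chain : Prop := {
  clt_bernoulli : is_bernoulli_chain L a c q y0 ;
  clt_a01 : forall k, 0 <= a k <= 1 ;
  clt_q01 : 0 <= q <= 1 ;
  clt_theta : 0 <= theta ;
  clt_W : 0 < W ;
  clt_m : (0 < m)%N ;
  clt_qW : q * (1 - q) = W / m%:R * (1 + 2 * theta) ;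
  clt_C : 1 <= C ;
  clt_aC : forall k, a k <= C / k.+1%:R ;
  clt_acC : forall k, `|q - a k * c k| <= C / k.+1%:R ;
  clt_akC : forall k, `|a k * k%:R - theta| <= C / k.+1%:R }.

Hypothesis H : clt_chain.

Lemma le_fourth_root (B : R) :
  \forall n \near \oo, B <= Num.sqrt (Num.sqrt (n%:R : R)).
Proof.
near=> n; apply: (le_trans (ler_norm B)).
have -> : `|B| = Num.sqrt (Num.sqrt (B ^+ 4)).
  rewrite -[4%N]/(2 * 2)%N exprM sqrtr_sqr (ger0_norm (sqr_ge0 B)).
  by rewrite sqrtr_sqr.
by rewrite !ler_wsqrtr//; near: n; exact: nbhs_infty_ger.
Unshelve. all: by end_near. Qed.

Lemma cvg_Phi (u : nat -> R) (l : R) :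
  u n @[n --> \oo] --> l -> Phi (u n) @[n --> \oo] --> Phi l.
Proof.
move=> ul; apply: continuous_cvg => //.
have ? := is_derive_Phi l.
by apply/differentiable_continuous/derivable1_diffP.
Qed.

(** With [v = eps^2 n] the three error terms are [O(n^(-1/4))], [O(n^(-1/2))] and [O(n^(-1/2))], and
    [v + (W / m) m (n - 1)] divided by [n] tends to [eps^2 + W]. *)
Lemma chain_smoothed_cdf (eps beta : R) : 0 < eps ->
  L (m * n.-1)%N (fun y => Phi ((beta * Num.sqrt n%:R - y) / (eps * Num.sqrt n%:R)))
    @[n --> \oo] --> Phi (beta / Num.sqrt (eps ^+ 2 + W)).
Proof.
move=> eps0; have [HL a01 q01 th0 W0 m0 qW C1 aC acC akC] := H.
have m0' : 0 < (m%:R : R) by rewrite ltr0n.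
have w0 : 0 <= W / m%:R by rewrite divr_ge0 ?ltW.
have [M HM] := chain_gaussian_approx L a c q y0 HL theta (W / m%:R) C a01 q01 th0 w0 qW
  C1 aC acC akC.
set E := W / m%:R * _ in HM.
pose g (n : nat) := Phi ((beta * Num.sqrt n%:R - backward_prod a (m * n.-1) 0 * y0)
   / Num.sqrt (eps ^+ 2 * n%:R + W / m%:R * (m * n.-1)%N%:R)).
have gl : g n @[n --> \oo] --> Phi (beta / Num.sqrt (eps ^+ 2 + W)).
  apply: cvg_Phi.
  pose num (n : nat) := beta - backward_prod a (m * n.-1) 0 * y0 / Num.sqrt n%:R.
  pose den (n : nat) := Num.sqrt (eps ^+ 2 + W - W / n%:R).
  have numl : num n @[n --> \oo] --> beta.
    apply/cvgrPdist_le => e e0; near=> n.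
    have n0 : 0 < Num.sqrt (n%:R : R).
      by rewrite sqrtr_gt0 ltr0n; near: n; exact: nbhs_infty_gt.
    rewrite /num opprB addrC subrK normrM normfV (gtr0_norm n0) ler_pdivrMr//.
    have /andP[A0 A1] := backward_prod01 a a01 (m * n.-1) 0.
    rewrite normrM (ger0_norm A0) (@le_trans _ _ `|y0|)//; first by rewrite ler_piMl.
    rewrite mulrC -ler_pdivrMr//.
    have h : Num.max 1 (`|y0| / e) <= Num.sqrt (Num.sqrt (n%:R : R)).
      by near: n; exact: le_fourth_root.
    move: h; rewrite ge_max => /andP[h1 h2]; apply: (le_trans h2).
    rewrite -[leRHS](@sqr_sqrtr _ (Num.sqrt n%:R)) ?sqrtr_ge0//.
    by rewrite ler_eXnr.
  have denl : den n @[n --> \oo] --> Num.sqrt (eps ^+ 2 + W).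
    apply: continuous_cvg; first exact: sqrt_continuous.
    rewrite -[X in _ --> X]subr0; apply: cvgB; first exact: cvg_cst.
    rewrite -[X in _ --> X](mulr0 W); apply: cvgM; first exact: cvg_cst.
    by rewrite -cvg_shiftS; exact: cvg_harmonic.
  have nd : num n / den n @[n --> \oo] --> beta / Num.sqrt (eps ^+ 2 + W).
    apply: cvgM => //; apply: cvgV => //.
    by rewrite gt_eqF// sqrtr_gt0 addr_gt0// exprn_gt0.
  apply: cvg_trans nd; apply: near_eq_cvg; near=> n.
  have n0 : (0 < n)%N by near: n; exact: nbhs_infty_gt.
  have nR : 0 < (n%:R : R) by rewrite ltr0n.
  have sn0 : 0 < Num.sqrt (n%:R : R) by rewrite sqrtr_gt0.
  have eW : 0 < eps ^+ 2 + W - W / n%:R.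
    have : W / n%:R <= W by rewrite ler_pdivrMr// ler_peMr ?(ltW W0)// ler1n.
    by have : 0 < eps ^+ 2 by [rewrite exprn_gt0|]; lra.
  have -> : eps ^+ 2 * n%:R + W / m%:R * (m * n.-1)%N%:R
      = n%:R * (eps ^+ 2 + W - W / n%:R).
    rewrite natrM -subn1 natrB//; field.
    by rewrite !gt_eqF.
  rewrite sqrtrM ?ltW// /num /den; field.
  by rewrite !gt_eqF// sqrtr_gt0.
pose A n := L (m * n.-1)%N (fun y =>
    Phi ((beta * Num.sqrt n%:R - y) / (eps * Num.sqrt n%:R))).
change (A @ \oo --> Phi (beta / Num.sqrt (eps ^+ 2 + W))).
have fg0 : (fun n => A n - g n) @ \oo --> (0 : R).
  apply/cvgrPdist_le => e e0.
  pose M1 := `|M| * m%:R ^+ 4 * (eps^-1 + eps^-2 + eps^-3).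
  near=> n; rewrite sub0r normrN /A.
  have n0 : (0 < n)%N by near: n; exact: nbhs_infty_gt.
  have nR : 0 < (n%:R : R) by rewrite ltr0n.
  have m1 : 1 <= (m%:R : R) by rewrite ler1n.
  pose v := eps ^+ 2 * n%:R.
  pose r : R := Num.sqrt (Num.sqrt n%:R).
  have r2 : r ^+ 2 = Num.sqrt n%:R by rewrite sqr_sqrtr ?sqrtr_ge0.
  have r4 : r ^+ 4 = n%:R by rewrite -[4%N]/(2 * 2)%N exprM r2 sqr_sqrtr.
  have sv : Num.sqrt v = eps * r ^+ 2 by rewrite sqrtrM ?sqr_ge0// sqrtr_sqr gtr0_norm// r2.
  have v0 : 0 < v by rewrite mulr_gt0// exprn_gt0.
  have rbig : Num.max 1 (Num.max eps^-1 (Num.max (2 * E / eps ^+ 2) (M1 / e)))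
      <= Num.sqrt (Num.sqrt (n%:R : R)).
    by near: n; exact: le_fourth_root.
  move: rbig; rewrite -/r !ge_max => /and4P[r1 re rE rM].
  have r0 : 0 < r by lra.
  have rr2 : r <= r ^+ 2 by rewrite ler_eXnr.
  have rr4 : r <= r ^+ 4 by rewrite ler_eXnr.
  have r22 : 1 <= r ^+ 2 by rewrite exprn_ege1.
  have s1 : (Num.sqrt v)^-1 <= 1.
    rewrite sv invf_le1 ?mulr_gt0 ?exprn_gt0//.
    by rewrite mulrC -ler_pdivrMr// mul1r (le_trans re).
  have Es : E * (Num.sqrt v)^-1 ^+ 2 <= 1 / 2.
    rewrite sv exprVn exprMn -exprM ler_pdivrMr ?mulr_gt0 ?exprn_gt0//.
    move: (le_trans rE rr4); rewrite ler_pdivrMr ?exprn_gt0//; lra.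
  have := HM (m * n.-1)%N v (beta * Num.sqrt n%:R) v0 s1 Es.
  rewrite sv r2 => /le_trans; apply.
  (* The number of steps is at most [x^4], so its square and fourth roots are bounded by powers of
     [x]. *)
  pose x : R := m%:R * r.
  have x0 : 0 <= x by rewrite mulr_ge0// ltW.
  have Kn : (m * n.-1)%N%:R <= x ^+ 4.
    rewrite exprMn r4 natrM ler_pM//; first by rewrite ler_eXnr.
    by rewrite ler_nat leq_pred.
  have sq2 z : 0 <= z -> Num.sqrt (z ^+ 2) = z by move=> ?; rewrite sqrtr_sqr ger0_norm.
  have Kn2 : Num.sqrt (m * n.-1)%N%:R <= x ^+ 2.
    rewrite -[leRHS]sq2 ?sqr_ge0// -exprM; exact: ler_wsqrtr.
  have Kn1 : Num.sqrt (Num.sqrt (m * n.-1)%N%:R) <= x.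
    by rewrite -[leRHS]sq2//; exact: ler_wsqrtr.
  set s := (eps * Num.sqrt n%:R)^-1.
  have sE : s = (eps * r ^+ 2)^-1 by rewrite r2.
  have s0 : 0 <= s by rewrite sE invr_ge0 mulr_ge0 ?ltW// exprn_gt0.
  apply: (@le_trans _ _ (`|M| * (s * x + s ^+ 2 * x ^+ 2 + s ^+ 3 * x ^+ 4))).
    apply: le_trans (ler_wpM2r _ (ler_norm M)) _.
      apply: addr_ge0; first apply: addr_ge0.
      - by rewrite mulr_ge0// sqrtr_ge0.
      - by rewrite mulr_ge0 ?sqr_ge0// sqrtr_ge0.
      - by rewrite mulr_ge0// exprn_ge0.
    apply: ler_wpM2l => //; by rewrite !lerD// ler_wpM2l// exprn_ge0.
  apply: (@le_trans _ _ (M1 / r)); last first.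
    by rewrite ler_pdivrMr// mulrC -ler_pdivrMr.
  have -> : M1 / r = `|M| * ((eps^-1 + eps^-2 + eps^-3) * r^-1 * m%:R ^+ 4).
    by rewrite /M1; ring.
  apply: ler_wpM2l => //.
  have rV0 : 0 < r^-1 by rewrite invr_gt0.
  have rV1 : r^-1 <= 1 by rewrite invf_le1.
  have eV0 : 0 < eps^-1 by rewrite invr_gt0.
  have -> : s * x = eps^-1 * r^-1 * m%:R.
    by rewrite sE /x; field; rewrite !gt_eqF.
  have -> : s ^+ 2 * x ^+ 2 = eps^-2 * (r^-1 * r^-1) * m%:R ^+ 2.
    by rewrite sE /x; field; rewrite !gt_eqF.
  have -> : s ^+ 3 * x ^+ 4 = eps^-3 * (r^-1 * r^-1) * m%:R ^+ 4.
    by rewrite sE /x; field; rewrite !gt_eqF.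
  have rr : r^-1 * r^-1 <= r^-1 by rewrite ler_piMl// ltW.
  rewrite !mulrDl; apply: lerD; first apply: lerD.
  - apply: ler_wpM2l; last exact: ler_eXnr.
    by apply: mulr_ge0; apply: ltW.
  - apply: ler_pM.
    + by apply: mulr_ge0; [rewrite invr_ge0 exprn_ge0// ltW|apply: mulr_ge0; apply: ltW].
    + exact: exprn_ge0.
    + by apply: ler_wpM2l => //; rewrite invr_ge0 exprn_ge0// ltW.
    + exact: ler_weXn2l.
  - apply: ler_wpM2r; first exact: exprn_ge0.
    by apply: ler_wpM2l => //; rewrite invr_ge0 exprn_ge0// ltW.
have -> : A = (fun n => A n - g n) \+ g by apply/funext => n; rewrite /= subrK.
by rewrite -[X in _ --> X]add0r; apply: cvgD.
Unshelve. all: by end_near. Qed.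

(** Shifted by [B] of its widths [eps sqrt n], the smoothed half-line lies above, or below, the
    sharp one up to [Phi (- B)]. [B] is fixed first, then [eps] so small that the shift and the
    extra variance hardly move the limit, then [n]; each costs [e / 3]. Weak and strict inequalities
    leave room for an atom at the threshold. *)
Lemma chain_cdf_bounds (beta e : R) : 0 < e ->
  \forall n \near \oo,
    L (m * n.-1)%N (fun y => (y <= beta * Num.sqrt n%:R)%R%:R)
      <= Phi (beta / Num.sqrt W) + e /\
    Phi (beta / Num.sqrt W) - e
      <= L (m * n.-1)%N (fun y => (y < beta * Num.sqrt n%:R)%R%:R).
Proof.
move=> e0; have [HL _ _ _ W0 _ _ _ _ _ _] := H.
have [B B0 PB] : exists2 B, 0 < B & Phi (- B) < e / 3.
  by apply: Phi_lt_eps; rewrite divr_gt0.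
have e30 : 0 < e / 3 by rewrite divr_gt0.
have cont (s : R) : \forall eps \near 0^'+,
    `|Phi (beta / Num.sqrt W) - Phi ((beta + s * eps) / Num.sqrt (eps ^+ 2 + W))| < e / 3.
  pose F (eps : R) := (beta + s * eps) / Num.sqrt (eps ^+ 2 + W).
  have F0 : F 0 = beta / Num.sqrt W by rewrite /F mulr0 addr0 expr0n add0r.
  have cF : Phi (F eps) @[eps --> 0] --> Phi (F 0).
    apply: continuous_cvg.
      have ? := is_derive_Phi (F 0).
      by apply/differentiable_continuous/derivable1_diffP.
    apply: cvgM.
      apply: cvgD; first exact: cvg_cst.
      by apply: cvgM; [exact: cvg_cst|exact: cvg_id].
    apply: cvgV; first by rewrite gt_eqF// sqrtr_gt0 expr0n add0r.
    apply: continuous_cvg; first exact: sqrt_continuous.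
    apply: cvgD; last exact: cvg_cst.
    exact: exprn_continuous.
  have /cvgrPdist_lt/(_ _ e30) : Phi (F eps) @[eps --> 0^'+] --> Phi (F 0).
    exact: cvg_at_right_filter.
  by rewrite F0.
near (0 : R)^'+ => eps.
have eps0 : 0 < eps by [].
have c1 : `|Phi (beta / Num.sqrt W) - Phi ((beta + B * eps) / Num.sqrt (eps ^+ 2 + W))| < e / 3.
  by near: eps; exact: cont.
have c2 : `|Phi (beta / Num.sqrt W) - Phi ((beta + (- B) * eps) / Num.sqrt (eps ^+ 2 + W))| < e / 3.
  by near: eps; exact: cont.
have s1 := chain_smoothed_cdf eps (beta + B * eps) eps0.
have s2 := chain_smoothed_cdf eps (beta + (- B) * eps) eps0.
move/cvgrPdist_lt : s1 => /(_ _ e30) s1; move/cvgrPdist_lt : s2 => /(_ _ e30) s2.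
near=> n.
have n0 : 0 < Num.sqrt (n%:R : R).
  by rewrite sqrtr_gt0 ltr0n; near: n; exact: nbhs_infty_gt.
have en0 : 0 < eps * Num.sqrt n%:R by rewrite mulr_gt0.
have PN := PhiN B.
split.
- have d1 : `|Phi ((beta + B * eps) / Num.sqrt (eps ^+ 2 + W)) -
    L (m * n.-1)%N (fun y => Phi (((beta + B * eps) * Num.sqrt n%:R - y) / (eps * Num.sqrt n%:R)))| < e / 3.
    by near: n; exact: s1.
  have : L (m * n.-1)%N (fun y => (y <= beta * Num.sqrt n%:R)%R%:R) <=
     L (m * n.-1)%N (fun y => Phi (((beta + B * eps) * Num.sqrt n%:R - y) / (eps * Num.sqrt n%:R))
       + Phi (- B)).
    apply: (chain_le _ _ _ _ _ HL) => y; case: (leP y) => [yb|_]; last first.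
      by rewrite addr_ge0// Phi_ge0.
    rewrite PN -lerBDr /= subKr; apply: Phi_le; rewrite ler_pdivlMr//; lra.
  rewrite (chainD _ _ _ _ _ HL) (chain_cst _ _ _ _ _ HL).
  move: d1 c1; rewrite !ltr_norml; lra.
- have d1 : `|Phi ((beta + (- B) * eps) / Num.sqrt (eps ^+ 2 + W)) -
    L (m * n.-1)%N (fun y => Phi (((beta + (- B) * eps) * Num.sqrt n%:R - y) / (eps * Num.sqrt n%:R)))| < e / 3.
    by near: n; exact: s2.
  have : L (m * n.-1)%N (fun y => Phi (((beta + (- B) * eps) * Num.sqrt n%:R - y) / (eps * Num.sqrt n%:R))) <=
    L (m * n.-1)%N (fun y => (y < beta * Num.sqrt n%:R)%R%:R + Phi (- B)).
    apply: (chain_le _ _ _ _ _ HL) => y; case: (ltP y) => [yb|yb].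
      by rewrite (le_trans (Phi_le1 _))// lerDl Phi_ge0.
    rewrite add0r; apply: Phi_le; rewrite ler_pdivrMr//; lra.
  rewrite (chainD _ _ _ _ _ HL) (chain_cst _ _ _ _ _ HL).
  move: d1 c2; rewrite !ltr_norml; lra.
Unshelve. all: by end_near. Qed.

Lemma chain_two_sided (beta : R) : 0 < beta ->
  L (m * n.-1)%N (fun y => (beta * Num.sqrt n%:R <= `|y|)%R%:R) @[n --> \oo]
    --> 2 * Phi (- (beta / Num.sqrt W)).
Proof.
move=> beta0; have [HL _ _ _ W0 _ _ _ _ _ _] := H.
apply/cvgrPdist_le => e e0; have e20 : 0 < e / 2 by rewrite divr_gt0.
have P1 := chain_cdf_bounds beta _ e20.
have P2 := chain_cdf_bounds (- beta) _ e20.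
have E := PhiN (beta / Num.sqrt W).
near=> n.
have [u1 l1] : L (m * n.-1)%N (fun y => (y <= beta * Num.sqrt n%:R)%R%:R)
      <= Phi (beta / Num.sqrt W) + e / 2 /\
    Phi (beta / Num.sqrt W) - e / 2
      <= L (m * n.-1)%N (fun y => (y < beta * Num.sqrt n%:R)%R%:R).
  by near: n; exact: P1.
have [u2 l2] : L (m * n.-1)%N (fun y => (y <= - beta * Num.sqrt n%:R)%R%:R)
      <= Phi (- beta / Num.sqrt W) + e / 2 /\
    Phi (- beta / Num.sqrt W) - e / 2
      <= L (m * n.-1)%N (fun y => (y < - beta * Num.sqrt n%:R)%R%:R).
  by near: n; exact: P2.
have n0 : 0 < Num.sqrt (n%:R : R).
  by rewrite sqrtr_gt0 ltr0n; near: n; exact: nbhs_infty_gt.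
have b0 : 0 < beta * Num.sqrt n%:R by rewrite mulr_gt0.
rewrite mulNr in u2 l2 *; rewrite !mulNr in u2 l2.
set b := beta * Num.sqrt n%:R in u1 l1 u2 l2 b0 *.
pose f (y : R) : R := (b <= `|y|)%R%:R.
rewrite -[X in `|_ - X|]/(L (m * n.-1)%N f).
(* The event [b <= |y|] is the complement of [y < b] joined with [y <= - b]; [h1] and [h2] compare
   indicators in whichever weak or strict form the one-sided bounds control. *)
have h1 : L (m * n.-1)%N (fun y => (y < b)%R%:R) + L (m * n.-1)%N f
    <= L (m * n.-1)%N (fun y => 1 + (y <= - b)%R%:R).
  rewrite -(chainD _ _ _ _ _ HL); apply: (chain_le _ _ _ _ _ HL) => y; rewrite /f.
  rewrite ler_normr.
  by case: (ltP y b) => h; case: (leP b (- y)) => h'; case: (leP y (- b)) => h'' /=; lra.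
have h2 : L (m * n.-1)%N (fun y => 1 + (y < - b)%R%:R)
    <= L (m * n.-1)%N (fun y => (y <= b)%R%:R) + L (m * n.-1)%N f.
  rewrite -(chainD _ _ _ _ _ HL); apply: (chain_le _ _ _ _ _ HL) => y; rewrite /f.
  rewrite ler_normr.
  by case: (leP y b) => h; case: (leP b (- y)) => h'; case: (ltP y (- b)) => h''; case: (leP b y) => h3 /=; lra.
move: h1 h2; rewrite !(chainD _ _ _ _ _ HL) !(chain_cst _ _ _ _ _ HL).
by rewrite ler_norml; lra.
Unshelve. all: by end_near. Qed.

End chain_cdf.

(** * Deterministic bookkeeping of degrees *)

Section graph_degrees.
Implicit Types (G : multigraph) (u : nat).
Local Open Scope nat_scope.

Lemma degree_cons e G u :
  degree (e :: G) u = (e.1 == u) + (e.2 == u) + degree G u.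
Proof. by rewrite /degree big_cons. Qed.

Lemma perm_degree G G' u : perm_eq G G' -> degree G u = degree G' u.
Proof. exact: perm_big. Qed.

(** Restricted to vertices below [t], so that vertex [t] is left out while it still receives its own
    edges; it joins the count on passing to [t + 1]. *)
Definition degree_count (k t : nat) G : nat := \sum_(u < t) (degree G u == k).

Lemma perm_degree_count k t G G' :
  perm_eq G G' -> degree_count k t G = degree_count k t G'.
Proof. by move=> p; apply: eq_bigr => u _; rewrite (perm_degree _ _ _ p). Qed.

Lemma num_degreeE k n G : num_degree k n G = degree_count k n.+1 G.
Proof.
rewrite /num_degree /degree_count -sum1_card big_mkcond/=.
by apply: eq_bigr => u _; rewrite inE; case: eqP.
Qed.

Context (m : nat) (v : nat -> nat -> nat).
Hypothesis vP : forall t i, 2 <= t -> 1 <= i <= m -> v t i < t.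

Lemma pa_subgraph0 t : pa_subgraph m v t.+1 0 = pa_graph m v t.
Proof. by []. Qed.

Lemma pa_subgraphS t i :
  pa_subgraph m v t i.+1 = (v t i.+1, t) :: pa_subgraph m v t i.
Proof. by []. Qed.

Lemma pa_graphE t : 2 <= t -> pa_graph m v t = pa_subgraph m v t m.
Proof. by case: t => [|[|t]]. Qed.

(** The induction over the edges of one vertex. An edge of the previous graph has both ends among
    the old vertices and a new edge only one, hence the total [2 m (t - 1) + i]. *)
Lemma degree_pa_subgraph_step t i : 2 <= t -> i <= m ->
  (forall u, t <= u -> degree (pa_subgraph m v t 0) u = 0) ->
  (forall u, u < t -> m <= degree (pa_subgraph m v t 0) u) ->
  \sum_(u < t) degree (pa_subgraph m v t 0) u = 2 * m * t.-1 ->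
  [/\ degree (pa_subgraph m v t i) t = i,
      forall u, t < u -> degree (pa_subgraph m v t i) u = 0,
      forall u, u < t -> m <= degree (pa_subgraph m v t i) u &
      \sum_(u < t) degree (pa_subgraph m v t i) u = 2 * m * t.-1 + i].
Proof.
move=> t2 im z0 ge0 sum0; elim: i im => [_|i IH im].
  by split => //; [exact: z0|move=> u tu; exact: z0 (ltnW tu)|rewrite addn0].
have [d1 d2 d3 d4] := IH (ltnW im).
have vt : v t i.+1 < t by apply: vP => //; rewrite im.
split.
- by rewrite pa_subgraphS degree_cons/= d1 eqxx ltn_eqF.
- move=> u tu; rewrite pa_subgraphS degree_cons/= d2// !ltn_eqF//.
  exact: ltn_trans tu.
- by move=> u ut; rewrite pa_subgraphS degree_cons/= (leq_trans (d3 _ ut))// leq_addl.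
- under eq_bigr do rewrite pa_subgraphS degree_cons/=.
  rewrite big_split/= d4 big_split/= addnC.
  rewrite (bigD1 (Ordinal vt))//= eqxx big1 ?addn0; last first.
    by move=> j /negbTE; rewrite -(inj_eq val_inj)/= eq_sym => ->.
  rewrite big1 ?addn0; last by move=> j _; rewrite gtn_eqF.
  by rewrite addn1 addnS.
Qed.

(* Edges of [G_{t,i}] join vertices at most [t]; the [i] edges at [t] are new. *)
Lemma degree_pa_subgraph t i : 2 <= t -> i <= m ->
  [/\ degree (pa_subgraph m v t i) t = i,
      forall u, t < u -> degree (pa_subgraph m v t i) u = 0,
      forall u, u < t -> m <= degree (pa_subgraph m v t i) u &
      \sum_(u < t) degree (pa_subgraph m v t i) u = 2 * m * t.-1 + i].
Proof.
move=> t2 im.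
suff [z0 ge0 sum0] : [/\ forall u, t <= u -> degree (pa_subgraph m v t 0) u = 0,
      forall u, u < t -> m <= degree (pa_subgraph m v t 0) u &
      \sum_(u < t) degree (pa_subgraph m v t 0) u = 2 * m * t.-1].
  exact: degree_pa_subgraph_step.
elim: t t2 {i im} => // -[//|[_ _|t IH _]].
  rewrite /pa_subgraph/=.
  have d u : degree (nseq m (0, 1)) u = m * ((0 == u) + (1 == u)).
    by rewrite /degree big_nseq iter_addn_0 mulnC.
  split => [u|u|]; rewrite ?d.
  - by case: u => [|[|u]]//; rewrite muln0.
  - by case: u => [|[|u]]//; rewrite muln1.
  - by rewrite big_ord_recl big_ord1 !d/=; lia.
have [z0 ge0 sum0] := IH isT.
have [d1 d2 d3 d4] := degree_pa_subgraph_step t.+2 m isT (leqnn m) z0 ge0 sum0.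
rewrite pa_subgraph0 pa_graphE//; split => //.
- by move=> u; rewrite ltnS leq_eqVlt => /predU1P[->|/d3//]; rewrite d1.
- by rewrite big_ord_recr/= d4 d1; lia.
Qed.

Lemma degree_count_pa_subgraph2 : degree_count m 2 (pa_subgraph m v 2 0) = 2.
Proof.
rewrite /degree_count /pa_subgraph/= big_ord_recl big_ord1.
by rewrite /degree !big_nseq/= !iter_addn_0 !mul1n !eqxx.
Qed.

Lemma degree_count_pa_subgraphS t i : 2 <= t -> i < m ->
  degree_count m t (pa_subgraph m v t i) =
  degree_count m t (pa_subgraph m v t i.+1) +
    (degree (pa_subgraph m v t i) (v t i.+1) == m).
Proof.
move=> t2 im; have [_ _ d3 _] := degree_pa_subgraph t i t2 (ltnW im).
have vt : v t i.+1 < t by apply: vP => //; rewrite im.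
rewrite /degree_count (bigD1 (Ordinal vt))//= [in RHS](bigD1 (Ordinal vt))//=.
have := d3 _ vt; rewrite pa_subgraphS degree_cons/= eqxx (gtn_eqF vt) => d.
rewrite [X in _ = X + _ + _](_ : _ = 0); last by apply/eqP; rewrite eqb0; lia.
rewrite add0n addnC; congr (_ + _); apply: eq_bigr => u /negbTE.
rewrite -(inj_eq val_inj)/= eq_sym => h.
by rewrite degree_cons/= h (gtn_eqF (ltn_ord u)).
Qed.

Lemma degree_count_pa_subgraph_next t : 2 <= t ->
  degree_count m t.+1 (pa_subgraph m v t.+1 0) =
  (degree_count m t (pa_subgraph m v t m)).+1.
Proof.
move=> t2; have [d1 _ _ _] := degree_pa_subgraph t m t2 (leqnn m).
by rewrite pa_subgraph0 pa_graphE// /degree_count big_ord_recr/= d1 eqxx addn1.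
Qed.

End graph_degrees.

(** * Random variables with finitely many values *)

Section simple_random_variables.
Context {d : measure_display} {T : measurableType d} {R : realType}.
Context (P : probability T R).

(** Graphs are not given a sigma-algebra; finitely many values with measurable fibres are enough to
    turn expectations into finite sums. *)
Definition finite_rv {U : choiceType} (F : T -> U) : Prop :=
  (exists s : seq U, forall w, F w \in s) /\
  (forall u, measurable [set w | F w = u]).

Lemma finite_rv_measurable {U : choiceType} (F : T -> U) (Q : U -> Prop) :
  finite_rv F -> measurable [set w | Q (F w)].
Proof.
move=> [[s Fs] mF].
have -> : [set w | Q (F w)] = \big[setU/set0]_(u <- s | `[< Q u >]) [set w | F w = u].
  rewrite -bigcup_seq_cond; apply/seteqP; split => w /=.
    by move=> QF; exists (F w) => //=; rewrite Fs; apply/asboolP.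
  by move=> [u /= /andP[_ /asboolP Qu] ->].
by apply: bigsetU_measurable => u _; exact: mF.
Qed.

Lemma finite_rv_cst {U : choiceType} (u : U) : finite_rv (fun=> u).
Proof.
split; first by exists [:: u] => w; rewrite mem_head.
move=> u'; have [->|/eqP uu'] := eqVneq u u'.
  by rewrite (_ : [set _ | _] = setT)//; apply/seteqP; split.
by rewrite (_ : [set _ | _] = set0)//; apply/seteqP; split.
Qed.

Lemma finite_rv_comp {U V : choiceType} (F : T -> U) (h : U -> V) :
  finite_rv F -> finite_rv (fun w => h (F w)).
Proof.
move=> fF; split; last first.
  by move=> v; exact: (finite_rv_measurable F (fun u => h u = v)).
by have [[s Fs] _] := fF; exists (map h s) => w; exact: map_f.
Qed.

Lemma finite_rv_pair {U V : choiceType} (F : T -> U) (G : T -> V) :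
  finite_rv F -> finite_rv G -> finite_rv (fun w => (F w, G w)).
Proof.
move=> [[s Fs] mF] [[s' Gs] mG]; split.
  by exists [seq (x, y) | x <- s, y <- s'] => w; exact: allpairs_f.
move=> [u u']; rewrite (_ : [set _ | _] = [set w | F w = u] `&` [set w | G w = u']).
  exact: measurableI.
by apply/seteqP; split => w /= [-> ->].
Qed.

Lemma finite_rv_integral {U : choiceType} (F : T -> U) (h : U -> R) (s : seq U) :
  finite_rv F -> uniq s -> (forall w, F w \in s) ->
  P.-integrable setT (EFin \o (fun w => h (F w))) /\
  \int[P]_w h (F w) = \sum_(u <- s) h u * fine (P [set w | F w = u]).
Proof.
move=> [_ mF] us Fs.
have E : EFin \o (fun w => h (F w)) =
    (fun w => \sum_(u <- s) (h u)%:E * (\1_[set w | F w = u] w)%:E)%E.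
  apply/funext => w /=; rewrite (bigD1_seq (F w))//= big1 ?adde0.
    by rewrite indicE mem_set// mule1.
  move=> u uF; rewrite indicE memNset ?mule0//= => Fu.
  by rewrite Fu eqxx in uF.
have I u : P.-integrable setT (fun w => (h u)%:E * (\1_[set w | F w = u] w)%:E)%E.
  apply: integrableZl => //; apply: integrable_indic => //.
split; first by rewrite E; exact: integrable_sum.
rewrite /Rintegral -[X in integral _ _ X]/(EFin \o (fun w => h (F w))) E.
have I2 u : (\int[P]_x ((h u)%:E * (\1_[set w | F w = u] x)%:E) =
    (h u * fine (P [set w | F w = u]))%:E)%E.
  rewrite integralZl//; last exact: integrable_indic.
  by rewrite integral_indic// setIT EFinM fineK// fin_num_measure.
by rewrite integral_sum// (eq_bigr _ (fun u _ => I2 u)) sumEFin.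
Qed.

Lemma finite_rv_integrable {U : choiceType} (F : T -> U) (h : U -> R) :
  finite_rv F -> P.-integrable setT (EFin \o (fun w => h (F w))).
Proof.
move=> fF; have [[s Fs] _] := fF.
have Fs' w : F w \in undup s by rewrite mem_undup.
by have [] := finite_rv_integral F h (undup s) fF (undup_uniq s) Fs'.
Qed.

Lemma finite_rv_prob {U : choiceType} (F : T -> U) (Q : U -> bool) :
  finite_rv F -> P [set w | Q (F w)] = (\int[P]_w (Q (F w))%:R)%:E.
Proof.
move=> fF; have mQ := finite_rv_measurable F Q fF.
rewrite /Rintegral fineK; last first.
  by apply: integrable_fin_num => //; exact: (finite_rv_integrable F (fun u => (Q u)%:R)).
transitivity (\int[P]_w (\1_[set w | Q (F w)] w)%:E)%E.
  by rewrite integral_indic// setIT.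
apply: eq_integral => w _; congr EFin; rewrite indicE.
have [QF|QF] := boolP (Q (F w)); first by rewrite mem_set.
by rewrite memNset//=; exact/negP.
Qed.

End simple_random_variables.

Section canonical_graph.

(* The attachment law is only given conditionally on events [perm_eq G g]; a canonical
   representative of each class turns these into the values of a random variable. *)
Definition canonical_graph (g : multigraph) : multigraph := choose (perm_eq g) g.

Lemma perm_canonical_graph g : perm_eq g (canonical_graph g).
Proof. exact: (chooseP (perm_refl g)). Qed.

Lemma canonical_graph_eq g g' : perm_eq g g' -> canonical_graph g = canonical_graph g'.
Proof.
move=> gg'; have e : perm_eq g =1 perm_eq g' by exact/permPl.
rewrite /canonical_graph (eq_choose e).
by apply: choose_id; rewrite ?perm_refl// perm_sym.
Qed.

End canonical_graph.

(** * The conditional law of one attachment *)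

Section attachment_process.
Context {R : realType} (m : nat) (delta : nat -> R).
Context {d : measure_display} {T : measurableType d} (P : probability T R).
Context (v : nat -> nat -> T -> nat).
Hypothesis HP : is_pa_process m delta P v.

Definition graph_at (t i : nat) (w : T) : multigraph :=
  pa_subgraph m (fun s j => v s j w) t i.

Definition count_at (t i : nat) (w : T) : nat := degree_count m t (graph_at t i w).

(** [i] counts the edges already placed, so the choice examined is the one with index [i + 1]. *)
Definition hit_at (t i : nat) (w : T) : bool :=
  degree (graph_at t i w) (v t i.+1 w) == m.

Definition total_weight (t i : nat) : R :=
  2 * m%:R * t.-1%:R + i%:R + t%:R * delta t.

Definition hit_rate (t i : nat) : R := (m%:R + delta t) / total_weight t i.

Lemma vertex_lt t i w : (2 <= t)%N -> (1 <= i <= m)%N -> (v t i w < t)%N.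
Proof. by move=> t2 im; have [_ + _] := HP t i t2 im; apply. Qed.

Lemma finite_rv_vertex t i : (2 <= t)%N -> (1 <= i <= m)%N -> finite_rv (v t i).
Proof.
move=> t2 im; have [mv vt _] := HP t i t2 im; split.
  by exists (iota 0 t) => w; rewrite mem_iota add0n/=; exact: vt.
move=> u; have := mv measurableT [set u].
by rewrite setTI => /(_ _); apply.
Qed.

Lemma finite_rv_graph t i : (2 <= t)%N -> (i <= m)%N -> finite_rv (graph_at t i).
Proof.
have step t' i' : (2 <= t')%N -> (i' <= m)%N -> finite_rv (graph_at t' 0) ->
    finite_rv (graph_at t' i').
  move=> t2 im g0; elim: i' im => [_|i' IH im]; first exact: g0.
  have fv : finite_rv (v t' i'.+1) by apply: finite_rv_vertex; rewrite ?im.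
  exact: (finite_rv_comp _ (fun p => (p.1, t') :: p.2)
    (finite_rv_pair _ _ fv (IH (ltnW im)))).
move=> t2 im; apply: (step) => //; elim: t t2 {i im} => // -[//|[_ _|t IH _]].
  exact: finite_rv_cst.
have := step t.+2 m isT (leqnn m) (IH isT).
by congr finite_rv; apply/funext => w; rewrite /graph_at pa_subgraph0 pa_graphE.
Qed.

Lemma finite_rv_count t i : (2 <= t)%N -> (i <= m)%N -> finite_rv (count_at t i).
Proof. by move=> t2 im; exact: (finite_rv_comp _ (degree_count m t) (finite_rv_graph _ _ t2 im)). Qed.

Lemma total_weightE t i w : (2 <= t)%N -> (i <= m)%N ->
  \sum_(j < t) ((degree (graph_at t i w) j)%:R + delta t) = total_weight t i.
Proof.
move=> t2 im.
have [|_ _ _ s] := degree_pa_subgraph m (fun s j => v s j w) _ t i t2 im.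
  by move=> t' i'; exact: vertex_lt.
rewrite big_split/= sumr_const card_ord -mulr_natl; congr (_ + _).
by rewrite -natr_sum s natrD !natrM.
Qed.

Hypothesis hdelta : forall t, - m%:R < delta t.

Lemma total_weight_gt0 t i : (2 <= t)%N -> 0 < total_weight t i.
Proof.
move=> t2; rewrite /total_weight.
have h := hdelta t; have m0 : 0 <= (m%:R : R) by [].
have tE : (t.-1%:R : R) = t%:R - 1 by rewrite -subn1 natrB// ltnW.
have tR : 2 <= (t%:R : R) by rewrite ler_nat.
have i0 : 0 <= (i%:R : R) by [].
rewrite tE; nra.
Qed.

(** The vertices of degree [m] carry together [(m + delta t)] times their number. This is part of
    the total weight, since every old vertex has degree at least [m] and hence positive weight. *)
Lemma hit_rate_count01 t i w : (2 <= t)%N -> (i <= m)%N ->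
  0 <= hit_rate t i * (count_at t i w)%:R <= 1.
Proof.
move=> t2 im; have S0 := total_weight_gt0 t i t2.
have h := hdelta t; have md : 0 < m%:R + delta t by lra.
apply/andP; split.
  by rewrite mulr_ge0// divr_ge0// ltW.
rewrite /hit_rate mulrAC ler_pdivrMr// mul1r -(total_weightE t i w)//.
rewrite /count_at /degree_count natr_sum mulr_sumr; apply: ler_sum => u _.
have [|_ _ d3 _] := degree_pa_subgraph m (fun s j => v s j w) _ t i t2 im.
  by move=> t' i'; exact: vertex_lt.
have du : (m%:R : R) <= (degree (graph_at t i w) u)%:R by rewrite ler_nat d3.
by case: eqP => [->|_]; rewrite ?mulr1// mulr0; lra.
Qed.

(** A conditional expectation given the graph. The law of the choice is known only fibre by fibre,
    so both integrals become sums over a vertex and a canonical graph, or over a canonical graph,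
    and are compared graph by graph. *)
Lemma integral_hit t i (phi : nat -> R) : (2 <= t)%N -> (i < m)%N ->
  \int[P]_w (phi (count_at t i w) * (hit_at t i w)%:R) =
  \int[P]_w (phi (count_at t i w) * (hit_rate t i * (count_at t i w)%:R)).
Proof.
move=> t2 im; pose C w := canonical_graph (graph_at t i w).
have fG := finite_rv_graph t i t2 (ltnW im).
have fC : finite_rv C by exact: finite_rv_comp.
have fv : finite_rv (v t i.+1) by apply: finite_rv_vertex.
have [[s0 Cs0] _] := fC; pose s := undup s0.
have us : uniq s by exact: undup_uniq.
have Cs w : C w \in s by rewrite mem_undup.
have cG w : degree_count m t (C w) = count_at t i w.
  by apply: perm_degree_count; rewrite perm_sym perm_canonical_graph.
have hG w u : degree (C w) u = degree (graph_at t i w) u.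
  by apply: perm_degree; rewrite perm_sym perm_canonical_graph.
pose h (p : nat * multigraph) : R :=
  phi (degree_count m t p.2) * (degree p.2 p.1 == m)%:R.
pose k (g : multigraph) : R :=
  phi (degree_count m t g) * (hit_rate t i * (degree_count m t g)%:R).
have -> : (fun w => phi (count_at t i w) * (hit_at t i w)%:R) =
    (fun w => h (v t i.+1 w, C w)).
  by apply/funext => w; rewrite /h/= cG hG.
have -> : (fun w => phi (count_at t i w) * (hit_rate t i * (count_at t i w)%:R)) =
    (fun w => k (C w)).
  by apply/funext => w; rewrite /k cG.
have [_ ->] := finite_rv_integral P C k s fC us Cs.
have uu : uniq [seq (u, g) | u <- iota 0 t, g <- s].
  by apply: allpairs_uniq => //; [exact: iota_uniq|case=> ? ? [? ?] /=].
have mu w : (v t i.+1 w, C w) \in [seq (u, g) | u <- iota 0 t, g <- s].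
  by apply: allpairs_f => //; rewrite mem_iota vertex_lt.
have [_ ->] := finite_rv_integral P (fun w => (v t i.+1 w, C w)) h _
  (finite_rv_pair _ _ fv fC) uu mu.
rewrite big_allpairs exchange_big/=; apply: eq_bigr => g _.
(* A listed [g] that is never attained has empty fibres. An attained one is canonical, so that
   [C w = g] is the event [perm_eq (graph_at t i w) g] of the attachment law. *)
have [[w0 Cw0]|nC] := pselect (exists w, C w = g); last first.
  have e0 : [set w | C w = g] = set0.
    by apply/seteqP; split => w // Cw; apply: nC; exists w.
  rewrite e0 measure0 mulr0 big1// => u _.
  rewrite (_ : [set _ | _] = set0) ?measure0 ?mulr0//.
  by apply/seteqP; split => w //= [_ Cw]; apply: nC; exists w.
have Cg : [set w | C w = g] = [set w | perm_eq (graph_at t i w) g].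
  apply/seteqP; split => w /= => [<-|]; first exact: perm_canonical_graph.
  move=> wg; rewrite -Cw0; apply: canonical_graph_eq.
  by rewrite (perm_trans wg)// -Cw0 perm_sym perm_canonical_graph.
have vg u : (u < t)%N -> fine (P [set w | (v t i.+1 w, C w) = (u, g)]) =
    attach_prob (delta t) t g u * fine (P [set w | C w = g]).
  move=> ut; have [_ _ /(_ g u ut)] := HP t i.+1 t2 im.
  rewrite /= -Cg => E.
  rewrite (_ : [set w | (v t i.+1 w, C w) = (u, g)] =
    [set w | v t i.+1 w = u /\ perm_eq (graph_at t i w) g]).
    have mCg : P [set w | C w = g] \is a fin_num.
      by apply: fin_num_measure; case: fC.
    by rewrite [P _]E fineM.
  apply/seteqP; split => w /= => [[<- <-]|[<- wg]].
    by split => //; exact: perm_canonical_graph.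
  by congr pair; have : [set w | C w = g] w by rewrite Cg.
have sumg : \sum_(j < t) ((degree g j)%:R + delta t) = total_weight t i.
  rewrite -(total_weightE t i w0 t2 (ltnW im)).
  by apply: eq_bigr => j _; rewrite -hG Cw0.
rewrite big_seq (eq_bigr (fun u => phi (degree_count m t g) * hit_rate t i *
  fine (P [set w | C w = g]) * (degree g u == m)%:R)); last first.
  move=> u; rewrite mem_iota /= add0n => ut; rewrite vg// /h/= /attach_prob sumg.
  by rewrite /hit_rate; case: eqP => [->|_]; rewrite ?mulr0 ?mul0r// !mulr1; ring.
rewrite -big_seq -mulr_sumr.
have -> : \sum_(u <- iota 0 t) ((degree g u == m)%:R : R) = (degree_count m t g)%:R.
  by rewrite /degree_count natr_sum -[in LHS](subn0 t) -/(index_iota 0 t) big_mkord.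
by rewrite /k; ring.
Qed.

End attachment_process.

(** * The centred count as a Bernoulli chain *)

Section attachment_chain.
Context {R : realType} (m : nat) (delta : nat -> R).
Context {d : measure_display} {T : measurableType d} (P : probability T R).
Context (v : nat -> nat -> T -> nat) (p q : R).
Hypothesis m0 : (0 < m)%N.
Hypothesis HP : is_pa_process m delta P v.
Hypothesis hdelta : forall t, - m%:R < delta t.
Hypothesis pq : p + m%:R * q = 1.

(* Step [k] of the chain attaches edge [k %% m + 1] of vertex [k %/ m + 2]. *)
Definition step_vertex (k : nat) : nat := (k %/ m).+2.
Definition step_edge (k : nat) : nat := (k %% m)%N.

(** A sawtooth: it falls by [q] with each edge, and at the last edge of vertex [t] it jumps to
    [p t], as the new vertex of degree [m] enters the count. Since [p + m q = 1], the centred count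
    moves by [q] minus the hit in both cases. *)
Definition center (k : nat) : R := p * (step_vertex k).-1%:R - (step_edge k)%:R * q.

Definition centered_count (k : nat) (w : T) : R :=
  (count_at m v (step_vertex k) (step_edge k) w)%:R - center k.

Definition step_rate (k : nat) : R :=
  hit_rate m delta (step_vertex k) (step_edge k).

Definition chain_expectation (k : nat) (f : R -> R) : R :=
  \int[P]_w f (centered_count k w).

Lemma step_edge_lt k : (step_edge k < m)%N.
Proof. by rewrite ltn_mod. Qed.

Lemma finite_rv_centered_count k : finite_rv (centered_count k).
Proof.
apply: (finite_rv_comp _ (fun n : nat => n%:R - center k)).
by apply: finite_rv_count HP _ _ _ _ => //; exact: ltnW (step_edge_lt k).
Qed.

Lemma integrable_chain k (f : R -> R) :
  P.-integrable setT (EFin \o (fun w => f (centered_count k w))).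
Proof. exact: finite_rv_integrable (finite_rv_centered_count k). Qed.

Lemma centered_count_step k w :
  centered_count k.+1 w = centered_count k w + q -
    (hit_at m v (step_vertex k) (step_edge k) w)%:R.
Proof.
have vP t i : (2 <= t)%N -> (1 <= i <= m)%N -> (v t i w < t)%N.
  exact: vertex_lt HP _ _ _.
have H : count_at m v (step_vertex k) (step_edge k) w =
    (degree_count m (step_vertex k)
       (pa_subgraph m (fun s j => v s j w) (step_vertex k) (step_edge k).+1) +
     hit_at m v (step_vertex k) (step_edge k) w)%N.
  exact: (degree_count_pa_subgraphS m (fun s j => v s j w) vP (step_vertex k) (step_edge k) isT (step_edge_lt k)).
rewrite /centered_count H natrD.
set h := (hit_at _ _ _ _ _)%:R.
have [dv|ndv] := boolP (m %| k.+1)%N.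
  have e1 : step_edge k.+1 = 0%N by apply/eqP.
  have e2 : step_vertex k.+1 = (step_vertex k).+1.
    by rewrite /step_vertex divnS// dv.
  have e3 : (step_edge k).+1 = m.
    move: dv; rewrite /step_edge /dvdn modnS.
    case: ifP => // /dvdnP[[//|x] E] _.
    have -> : k = (x * m + m.-1)%N by move: m0 E; case: m => //= ? _; rewrite mulSn; lia.
    by rewrite modnMDl modn_small prednK.
  rewrite /center e1 e2 e3 /count_at /graph_at.
  rewrite (degree_count_pa_subgraph_next m _ vP)// -natr1.
  have -> : ((step_vertex k).+1.-1%:R : R) = (step_vertex k).-1%:R + 1 by rewrite /step_vertex/= -natr1.
  have -> : (step_edge k)%:R = m%:R - 1 :> R by rewrite -e3 -natr1 addrK.
  by have := pq; lra.
have e1 : step_edge k.+1 = (step_edge k).+1 by rewrite /step_edge modnS (negbTE ndv).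
have e2 : step_vertex k.+1 = step_vertex k.
  by rewrite /step_vertex divnS// (negbTE ndv).
by rewrite /center e1 e2 -[(step_edge k).+1%:R]natr1 /count_at /graph_at; ring.
Qed.

Lemma chain_expectation_bernoulli :
  is_bernoulli_chain chain_expectation step_rate center q (2 - p).
Proof.
have sv k : (2 <= step_vertex k)%N by [].
split.
- move=> k s f g; rewrite /chain_expectation RintegralD//.
  + by rewrite RintegralZl//; exact: integrable_chain.
  + exact: (integrable_chain k (fun y => s * f y)).
  + exact: integrable_chain.
- move=> k f g fg; apply: le_Rintegral => //; try exact: integrable_chain.
  move=> w _; apply: fg; rewrite /centered_count subrK.
  by apply: hit_rate_count01 HP hdelta _ _ _ _ _ => //; exact: ltnW (step_edge_lt k).
- move=> f; rewrite /chain_expectation.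
  (* Initially there are two vertices, both of degree [m], and the centre is [p]. *)
  have -> : (fun w => f (centered_count 0 w)) = cst (f (2 - p)).
    apply/funext => w; rewrite /centered_count /center /step_edge /step_vertex.
    rewrite div0n mod0n mul0r subr0 mulr1 /count_at /graph_at.
    by rewrite degree_count_pa_subgraph2.
  rewrite Rintegral_cst// [X in fine X](_ : _ = 1%E) ?mulr1//; exact: probability_setT.
- move=> k f; set t := step_vertex k; set i := step_edge k.
  have im : (i < m)%N := step_edge_lt k.
  (* The value of [f] after the step is [f (y + q)] plus this difference times the hit, hence linear
     in the hit as [integral_hit] requires. *)
  pose phi (n : nat) := f (n%:R - center k + q - 1) - f (n%:R - center k + q).
  have fh : finite_rv (hit_at m v t i).
    apply: (finite_rv_comp (fun w => (v t i.+1 w, graph_at m v t i w))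
      (fun x => degree x.2 x.1 == m)).
    apply: finite_rv_pair.
      by apply: finite_rv_vertex HP _ _ _ _.
    by apply: finite_rv_graph HP _ _ _ _ => //; exact: ltnW.
  have fc : finite_rv (count_at m v t i).
    by apply: finite_rv_count HP _ _ _ _ => //; exact: ltnW.
  have I1 : P.-integrable setT (EFin \o (fun w => phi (count_at m v t i w) * (hit_at m v t i w)%:R)).
    exact: (finite_rv_integrable P (fun w => (count_at m v t i w, hit_at m v t i w))
      (fun x => phi x.1 * x.2%:R) (finite_rv_pair _ _ fc fh)).
  have I2 : P.-integrable setT (EFin \o (fun w => phi (count_at m v t i w) *
      (hit_rate m delta t i * (count_at m v t i w)%:R))).
    exact: (finite_rv_integrable P (count_at m v t i)
      (fun n => phi n * (hit_rate m delta t i * n%:R)) fc).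
  have I3 := integrable_chain k (fun y => f (y + q)).
  rewrite /chain_expectation.
  transitivity (\int[P]_w (f (centered_count k w + q) +
      phi (count_at m v t i w) * (hit_at m v t i w)%:R)).
    apply: eq_Rintegral => w _; rewrite centered_count_step -/t -/i /phi.
    rewrite -/(centered_count k w); case: (hit_at _ _ _ _ _) => /=.
      by rewrite mulr1 /centered_count -/t -/i; ring.
    by rewrite mulr0 subr0 addr0.
  rewrite RintegralD// (integral_hit m delta P v HP)// -RintegralD//.
  apply: eq_Rintegral => w _.
  rewrite /step_rate -/t -/i /phi /centered_count -/t -/i; ring.
Qed.

Lemma chain_expectation_prob k (Q : R -> bool) :
  P [set w | Q (centered_count k w)] = (chain_expectation k (fun y => (Q y)%:R))%:E.
Proof. exact: finite_rv_prob (finite_rv_centered_count k). Qed.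

(** After [m (n - 1)] steps the chain stands at vertex [n + 1] with no edge placed, that is at
    [G_n], where the centre is [n p]. *)
Lemma centered_count_T_stat n w : (0 < n)%N ->
  centered_count (m * n.-1)%N w =
    (num_degree m n (random_graph m v n w))%:R - n%:R * p.
Proof.
move=> n0; rewrite /centered_count /center /step_edge /step_vertex.
rewrite mulKn// modnMr mul0r subr0 prednK// num_degreeE /=.
by rewrite mulrC.
Qed.

End attachment_chain.

(** * Asymptotics of the jump rates *)

Section attachment_rates.
Context {R : realType} (m : nat).
Hypothesis m0 : (0 < m)%N.
Implicit Types (dl p q : R) (delta : nat -> R).

(** The limit [theta] of [k] times the rate of step [k]. *)
Definition loss_rate dl : R := m%:R * (m%:R + dl) / (2 * m%:R + dl).

(** Writing [k = j m + i] turns [m] times the total weight into a term linear in [k] plus a bounded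
    term, positive because [i < m]. *)
Lemma step_rateE delta k dl : - m%:R < dl -> delta (step_vertex m k) = dl ->
  step_rate m delta k = m%:R * (m%:R + dl) /
    ((2 * m%:R + dl) * k%:R + (m%:R + dl) * (2 * m%:R - (step_edge m k)%:R)).
Proof.
move=> hdl dE; have mR : 0 < (m%:R : R) by rewrite ltr0n.
have im : (step_edge m k)%:R < (m%:R : R) by rewrite ltr_nat step_edge_lt.
rewrite /step_rate /hit_rate /total_weight dE.
have kE : (k%:R : R) = (k %/ m)%N%:R * m%:R + (step_edge m k)%:R.
  by rewrite -natrM -natrD -divn_eq.
have tE : ((step_vertex m k)%:R : R) = (k %/ m)%N%:R + 2 by rewrite /step_vertex -!natr1; ring.
have t1E : ((step_vertex m k).-1%:R : R) = (k %/ m)%N%:R + 1 by rewrite /step_vertex/= -natr1.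
rewrite kE tE t1E; set j : R := (k %/ m)%N%:R; set i : R := (step_edge m k)%:R in im *.
have j0 : 0 <= j by rewrite /j.
have i0 : 0 <= i by rewrite /i.
have jg : 0 <= j * (2 * m%:R + dl) by rewrite mulr_ge0//; lra.
field; apply/andP; split; rewrite gt_eqF//.
- have : 0 <= (m%:R : R) * (j * (2 * m%:R + dl)) by rewrite mulr_ge0// ltW.
  have : 0 <= dl * i + 2 * m%:R * i - dl * i - m%:R * i by nra.
  have : 0 < (m%:R + dl) * (2 * m%:R - i) by rewrite mulr_gt0//; lra.
  have : 0 <= (2 * m%:R + dl) * i by rewrite mulr_ge0//; lra.
  by lra.
- by lra.
Qed.

(** [C] depends on [dl] alone and the hypothesis concerns a single step: under the alternative
    [delta] changes value along the sequence and varies with [n]. *)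
Lemma step_rate_bounds dl : - m%:R < dl -> exists2 C : R, 1 <= C &
  forall delta k, delta (step_vertex m k) = dl ->
    [/\ 0 <= step_rate m delta k <= 1, step_rate m delta k <= C / k.+1%:R &
        `|step_rate m delta k * k%:R - loss_rate dl| <= C / k.+1%:R].
Proof.
move=> hdl; have mR : 1 <= (m%:R : R) by rewrite ler1n.
set g := m%:R + dl; have g0 : 0 < g by rewrite /g; lra.
set D := 2 * m%:R + dl; have D0 : m%:R <= D by rewrite /D; lra.
have Dp : 0 < D by lra.
pose B := 1 + g^-1; have gV0 : 0 < g^-1 by rewrite invr_gt0.
pose C1 := m%:R * g * B; pose C2 := m%:R * g / D * (2 * m%:R * g) * B.
have B0 : 0 < B by rewrite /B; lra.
have C10 : 0 < C1 by rewrite !mulr_gt0//; lra.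
have C20 : 0 < C2 by rewrite !mulr_gt0 ?invr_gt0//; lra.
exists (1 + C1 + C2); first by lra.
move=> delta k dE; rewrite (step_rateE delta k dl)// -/g -/D.
set i : R := (step_edge m k)%:R.
have im : i <= m%:R by rewrite ler_nat ltnW// step_edge_lt.
have i0 : 0 <= i by rewrite /i.
have k0 : 0 <= (k%:R : R) by [].
set S := D * k%:R + g * (2 * m%:R - i).
have gm : g * m%:R <= g * (2 * m%:R - i) by rewrite ler_wpM2l ?(ltW g0)//; lra.
have Dk : m%:R * k%:R <= D * k%:R by rewrite ler_wpM2r.
have mk0 : k%:R <= m%:R * k%:R :> R by rewrite ler_peMl.
have gm1 : g <= g * m%:R by rewrite ler_peMr// ltW.
have S0 : 0 < S by rewrite /S; lra.
(* From [S >= k + g] and [(1 + 1/g) (k + g) >= k + 1]. *)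
have SV : S^-1 <= B / k.+1%:R.
  rewrite -[S^-1]mul1r ler_pdivrMr// mulrAC ler_pdivlMr ?ltr0n// mul1r.
  rewrite -natr1; have gg : g^-1 * g = 1 by rewrite mulVf// gt_eqF.
  have h1 : k%:R + g <= S by rewrite /S; lra.
  have h2 : 0 <= g^-1 * (S - k%:R - g) by rewrite mulr_ge0 ?(ltW gV0)//; lra.
  have h3 : 0 <= g^-1 * k%:R by rewrite mulr_ge0// ltW.
  rewrite /B; nra.
have kV : 0 < (k.+1%:R : R)^-1 by rewrite invr_gt0 ltr0n.
have a0 : 0 <= m%:R * g / S by rewrite mulr_ge0 ?invr_ge0 ?(ltW S0)// mulr_ge0// ltW.
have bnd x : x <= 1 + C1 + C2 -> x / k.+1%:R <= (1 + C1 + C2) / k.+1%:R.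
  by move=> xC; rewrite ler_wpM2r// ltW.
split.
- rewrite a0/= ler_pdivrMr// mul1r mulrC /S.
  have : 0 <= D * k%:R by rewrite mulr_ge0// ltW.
  by lra.
- apply: (@le_trans _ _ (C1 / k.+1%:R)); last by apply: bnd; lra.
  rewrite /C1 -[leRHS]mulrA; apply: ler_wpM2l => //.
  by rewrite mulr_ge0// ltW.
- apply: (@le_trans _ _ (C2 / k.+1%:R)); last by apply: bnd; lra.
  have -> : m%:R * g / S * k%:R - loss_rate dl =
      - (m%:R * g / D * (g * (2 * m%:R - i)) * S^-1).
    rewrite /loss_rate -/g -/D; have Sn : S != 0 by rewrite gt_eqF.
    have Dn : D != 0 by rewrite gt_eqF.
    have SE : D * k%:R = S - g * (2 * m%:R - i) by rewrite /S addrK.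
    have -> : (k%:R : R) = (S - g * (2 * m%:R - i)) / D by rewrite -SE mulrC mulKf.
    by field; rewrite Sn Dn.
  have mgD : 0 <= m%:R * g / D by rewrite !mulr_ge0 ?invr_ge0 ?(ltW Dp) ?(ltW g0).
  have gi : 0 <= g * (2 * m%:R - i) by rewrite mulr_ge0 ?(ltW g0)//; lra.
  have S0' : 0 <= S^-1 by rewrite invr_ge0 ltW.
  rewrite normrN ger0_norm; last by apply: mulr_ge0 => //; exact: mulr_ge0.
  rewrite /C2 -[leRHS]mulrA; apply: ler_pM => //; first exact: mulr_ge0.
  apply: ler_wpM2l => //; rewrite mulrC (mulrC (2 * _)) mulrC ler_wpM2l ?(ltW g0)//; lra.
Qed.

(** The centre is [p k / m] up to a bounded error, so rate times centre tends to [p theta / m]. For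
    the null parameters this limit is [q] and the drift is [O(1/k)]; a changed parameter leaves a
    constant drift. *)
Lemma step_drift_bounds dl p q : - m%:R < dl -> 0 <= p <= 1 -> p + m%:R * q = 1 ->
  exists2 C : R, 1 <= C & forall delta k, delta (step_vertex m k) = dl ->
    [/\ 0 <= step_rate m delta k <= 1, step_rate m delta k <= C / k.+1%:R,
        `|step_rate m delta k * k%:R - loss_rate dl| <= C / k.+1%:R &
        `|step_rate m delta k * center m p q k - p * loss_rate dl / m%:R|
          <= C / k.+1%:R].
Proof.
move=> hdl /andP[p0 p1] pq; have [C C1 HC] := step_rate_bounds dl hdl.
exists (2 * C); first by lra.
move=> delta k /HC[a01 aC akC]; have mR : 1 <= (m%:R : R) by rewrite ler1n.
have kV : 0 < (k.+1%:R : R)^-1 by rewrite invr_gt0 ltr0n.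
have C2 : C / k.+1%:R <= 2 * C / k.+1%:R by rewrite ler_wpM2r ?(ltW kV)//; lra.
split => //; [exact: le_trans aC C2|exact: le_trans akC C2|].
set a := step_rate m delta k in a01 aC akC *; set i : R := (step_edge m k)%:R.
have im : i <= m%:R by rewrite ler_nat ltnW// step_edge_lt.
have i0 : 0 <= i by rewrite /i.
have kE : (k%:R : R) = (k %/ m)%N%:R * m%:R + i.
  by rewrite -natrM -natrD -divn_eq.
have t1E : ((step_vertex m k).-1%:R : R) = (k %/ m)%N%:R + 1 by rewrite /step_vertex/= -natr1.
have cE : center m p q k = (p * k%:R + (p * m%:R - i)) / m%:R.
  rewrite /center t1E -/i kE (_ : q = (1 - p) / m%:R); last first.
    have -> : 1 - p = m%:R * q by lra.
    by field; rewrite gt_eqF//; lra.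
  by field; rewrite gt_eqF//; lra.
rewrite cE.
have -> : a * ((p * k%:R + (p * m%:R - i)) / m%:R) - p * loss_rate dl / m%:R =
   (p * (a * k%:R - loss_rate dl) + a * (p * m%:R - i)) / m%:R by ring.
rewrite normrM normfV (ger0_norm (ler0n _ m)) ler_pdivrMr; last by lra.
rewrite (le_trans (ler_normD _ _))// [`|p * _|]normrM [`|a * _|]normrM (ger0_norm p0).
have /andP[a0 a1] := a01; rewrite (ger0_norm a0).
set y := C / k.+1%:R in aC akC C2 *.
have y0 : 0 <= y by rewrite mulr_ge0 ?(ltW kV)//; lra.
have b1 : p * `|a * k%:R - loss_rate dl| <= y.
  by rewrite (le_trans _ akC)// ler_piMl.
have b2 : a * `|p * m%:R - i| <= y * m%:R.
  apply: ler_pM => //; rewrite ler_norml.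
  have : p * m%:R <= m%:R by rewrite ler_piMl.
  have : 0 <= p * m%:R by rewrite mulr_ge0.
  by move=> *; apply/andP; split; lra.
have -> : 2 * C / k.+1%:R = 2 * y by rewrite /y; ring.
have : y <= y * m%:R by rewrite ler_peMr.
lra.
Qed.

End attachment_rates.

(** * Identities between the constants of the null model *)

Section null_parameters.
Context {R : realType} (m : nat) (delta0 : R).
Hypothesis m0 : (0 < m)%N.
Hypothesis hdelta0 : - m%:R < delta0.

Definition hit_prob : R := (1 - p_m m delta0) / m%:R.

Lemma loss_rate_gt0 (dl : R) : - m%:R < dl -> 0 < loss_rate m dl.
Proof.
move=> h; have mR : 0 < (m%:R : R) by rewrite ltr0n.
by rewrite /loss_rate divr_gt0 ?mulr_gt0//; lra.
Qed.

(** At equilibrium the count grows by [p] per vertex: one vertex enters and [p theta] leave, so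
    [p = 1 - p theta]. *)
Lemma p_mE : p_m m delta0 = (1 + loss_rate m delta0)^-1.
Proof.
have mR : 0 < (m%:R : R) by rewrite ltr0n.
have h := hdelta0; have md : 0 < m%:R * (m%:R + delta0) by rewrite mulr_gt0//; lra.
rewrite /p_m /loss_rate; field; rewrite !gt_eqF//; lra.
Qed.

Lemma p_m01 : 0 < p_m m delta0 < 1.
Proof.
have t0 := loss_rate_gt0 _ hdelta0.
by rewrite p_mE invr_gt0 invf_lt1; lra.
Qed.

Lemma p_m_hit_prob : p_m m delta0 + m%:R * hit_prob = 1.
Proof.
rewrite /hit_prob; have : (m%:R : R) != 0 by rewrite pnatr_eq0 -lt0n.
by move=> ?; field.
Qed.

Lemma hit_probE : hit_prob = p_m m delta0 * loss_rate m delta0 / m%:R.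
Proof.
have t0 := loss_rate_gt0 _ hdelta0; have mR : 0 < (m%:R : R) by rewrite ltr0n.
by rewrite /hit_prob p_mE; field; rewrite !gt_eqF//; lra.
Qed.

Lemma hit_prob01 : 0 <= hit_prob <= 1.
Proof.
have /andP[? ?] := p_m01; have mR : 1 <= (m%:R : R) by rewrite ler1n.
rewrite /hit_prob ler_pdivrMr; last by lra.
by rewrite divr_ge0//=; lra.
Qed.

Lemma w_var_gt0 : 0 < w_var delta0 m.
Proof.
have h := hdelta0; have mR : 1 <= (m%:R : R) by rewrite ler1n.
have g0 : 0 < m%:R + delta0 by lra.
have mg : 0 < m%:R * (m%:R + delta0) by rewrite mulr_gt0//; lra.
by rewrite /w_var divr_gt0// !mulr_gt0 ?exprn_gt0//; nra.
Qed.

(** This identifies [w_var] as [m] times the solution [w] of the balance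
    [q (1 - q) = w (1 + 2 theta)]. *)
Lemma hit_prob_variance :
  hit_prob * (1 - hit_prob) = w_var delta0 m / m%:R * (1 + 2 * loss_rate m delta0).
Proof.
have h := hdelta0; have mR : 1 <= (m%:R : R) by rewrite ler1n.
have mg : 0 < m%:R * (m%:R + delta0) by rewrite mulr_gt0//; lra.
rewrite hit_probE p_mE /w_var /loss_rate.
by field; rewrite !gt_eqF//; lra.
Qed.

End null_parameters.

Lemma psi_calE {R : realType} (m : nat) (delta0 alpha : R)
    {d : measure_display} {T : measurableType d}
    (v : nat -> nat -> T -> nat) (n : nat) (x : T) : (0 < m)%N -> (0 < n)%N ->
  psi_cal m delta0 alpha n (random_graph m v n x) =
  (Num.sqrt (n%:R * w_var delta0 m) * z_quantile (alpha / 2) <=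
    `|centered_count m v (p_m m delta0) (hit_prob m delta0) (m * n.-1) x|)%R :> nat.
Proof. by move=> m0 n0; rewrite /psi_cal /T_stat -(centered_count_T_stat m v _ (hit_prob m delta0)). Qed.

(** * The type-I error *)

Section null_model.
Context {R : realType} (m : nat) (delta0 : R).
Hypothesis m0 : (0 < m)%N.
Hypothesis hdelta0 : - m%:R < delta0.
Context {d : measure_display} {T : measurableType d} (P : probability T R).
Context (v : nat -> nat -> T -> nat).
Hypothesis HP : is_pa_process m (delta_null delta0) P v.

Lemma null_clt_chain : exists C : R,
  clt_chain (chain_expectation m P v (p_m m delta0) (hit_prob m delta0))
    (step_rate m (delta_null delta0)) (center m (p_m m delta0) (hit_prob m delta0))
    (hit_prob m delta0) (2 - p_m m delta0) (loss_rate m delta0) (w_var delta0 m) C m.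
Proof.
have p01 : 0 <= p_m m delta0 <= 1 by have /andP[? ?] := p_m01 m delta0 m0 hdelta0; lra.
have pq := p_m_hit_prob m delta0 m0.
have [C C1 HC] := step_drift_bounds m m0 delta0 _ _ hdelta0 p01 pq.
exists C; split => //.
- by apply: chain_expectation_bernoulli => // t; rewrite /delta_null.
- by move=> k; have [] := HC (delta_null delta0) k erefl.
- exact: hit_prob01.
- exact/ltW/loss_rate_gt0.
- exact: w_var_gt0.
- exact: hit_prob_variance.
- by move=> k; have [] := HC (delta_null delta0) k erefl.
- move=> k; have [_ _ _] := HC (delta_null delta0) k erefl.
  by rewrite -hit_probE// distrC.
- by move=> k; have [] := HC (delta_null delta0) k erefl.
Qed.

Lemma type_I_error (alpha : R) : 0 < alpha < 1 ->
  P [set w | psi_cal m delta0 alpha n (random_graph m v n w) <> 0%N] @[n --> \oo]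
    --> alpha%:E.
Proof.
move=> /andP[a0 a1]; set z := z_quantile (alpha / 2).
have Pz : Phi (- z) = alpha / 2 by apply: z_quantileP; lra.
(* The two-sided limit needs a positive threshold, which follows from
   [alpha / 2 < 1 / 2 = Phi 0]. *)
have z0 : 0 < z.
  rewrite ltNge; apply/negP => zle; have := Phi_le (R := R) 0 (- z).
  by rewrite Phi0 Pz => /(_ ltac:(lra)); lra.
have [C HC] := null_clt_chain.
have W0 := w_var_gt0 m delta0 m0 hdelta0.
have sW0 : 0 < Num.sqrt (w_var delta0 m) by rewrite sqrtr_gt0.
have beta0 : 0 < Num.sqrt (w_var delta0 m) * z by rewrite mulr_gt0.
have := chain_two_sided _ _ _ _ _ _ _ _ _ HC _ beta0.
rewrite (mulrC _ z) mulfK ?gt_eqF// Pz (_ : 2 * (alpha / 2) = alpha); last by field.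
set u := (X in X @ _ --> _) => lim.
have : (EFin \o u) @ \oo --> alpha%:E by apply: cvg_EFin; [exact: nearW|exact: lim].
apply: cvg_trans; apply: near_eq_cvg; near=> n.
have n0 : (0 < n)%N by near: n; exact: nbhs_infty_gt.
rewrite /= /u -(chain_expectation_prob _ _ _ _ _ _ m0 HP).
congr (P _); apply/seteqP.
have E x : psi_cal m delta0 alpha n (random_graph m v n x) =
    (z * Num.sqrt (w_var delta0 m) * Num.sqrt n%:R <=
    `|centered_count m v (p_m m delta0) (hit_prob m delta0) (m * n.-1) x|)%R :> nat.
  rewrite psi_calE// -/z sqrtrM//; congr (nat_of_bool (_ <= _)); ring.
by split => x /=; rewrite E; case: (_ <= _).
Unshelve. all: by end_near. Qed.

End null_model.

(** * Response of the mean to a change of drift *)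

Section mean_shift.
Context {R : realType} (a c : nat -> R) (q y0 C kappa : R) (k0 K : nat).

(** A bootstrap. A crude bound lets the mean grow linearly after [k0]; put back into the recursion
    it makes each damping [a k * mu k] at most [C / (k0 + 1)] times that bound, so the mean follows
    the drift [kappa]. Over a window of length [L] the damping totals [O(L (B + L) / k0)], small
    against [L] once [B] and [L] are small against [k0]. *)
Lemma chain_mean_shift :
  let B := `|y0| + 4 * C * Num.sqrt (Num.sqrt K%:R) in
  (k0 <= K)%N -> 0 <= C ->
  (forall k, 0 <= a k <= 1) -> (forall k, a k <= C / k.+1%:R) ->
  (forall k, (k < k0)%N -> `|q - a k * c k| <= C / k.+1%:R) ->
  (forall k, (k0 <= k < K)%N -> `|q - a k * c k - kappa| <= C / k.+1%:R) ->
  `|chain_mean a c q y0 K - kappa * (K - k0)%N%:R| <=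
    2 * B + (K - k0)%N%:R * (C / k0.+1%:R * (B + (`|kappa| + C) * (K - k0)%N%:R)).
Proof.
move=> B k0K C0 a01 aC h0 h1.
have harm k l : (k <= l)%N -> (l <= K)%N ->
    C * (\sum_(k <= j < l) j.+1%:R^-1) <= 4 * C * Num.sqrt (Num.sqrt K%:R).
  move=> kl lK; have -> : 4 * C * Num.sqrt (Num.sqrt K%:R) =
    C * (4 * Num.sqrt (Num.sqrt K%:R)) by ring.
  apply: ler_wpM2l => //.
  apply: le_trans (sum_inv_le K).
  rewrite -(big_mkord xpredT (fun j => (j.+1%:R : R)^-1)).
  rewrite (big_cat_nat (leq0n k) (leq_trans kl lK))/=.
  rewrite [X in _ <= _ + X](big_cat_nat kl lK)/=.
  have nn i j : 0 <= \sum_(i <= x < j) (x.+1%:R : R)^-1.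
    by apply: sumr_ge0 => x _; rewrite invr_ge0.
  by have := nn 0%N k; have := nn l K; lra.
pose mu k := chain_mean a c q y0 k.
have y0ge := normr_ge0 y0; have kge := normr_ge0 kappa.
have B0 : 0 <= B by rewrite addr_ge0// !mulr_ge0// sqrtr_ge0.
have muk0 : `|mu k0| <= B.
  apply: le_trans (chain_mean_drift _ _ _ _ a01 C 0 k0 (leq0n _) _) _.
    by move=> j /andP[_ jk]; exact: h0.
  by rewrite /= lerD2l harm.
have Cle k : C / k.+1%:R <= C by rewrite ler_piMr// invf_le1 ?ltr0n// ler1n.
have crude i : (k0 + i <= K)%N -> `|mu (k0 + i)%N| <= B + (`|kappa| + C) * i%:R.
  elim: i => [_|i IH iK]; first by rewrite addn0 mulr0 addr0.
  have /IH {}IH : (k0 + i <= K)%N by apply: leq_trans iK; rewrite leq_add2l.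
  have /andP[l0 l1] := a01 (k0 + i)%N.
  have kk : (k0 <= k0 + i < K)%N by rewrite leq_addr/= -addnS.
  have hk := le_trans (h1 _ kk) (Cle _).
  rewrite /mu addnS/= -/(mu (k0 + i)%N) (le_trans (ler_normD _ _))//.
  have e1 : `|(1 - a (k0 + i)%N) * mu (k0 + i)%N| <= `|mu (k0 + i)%N|.
    by rewrite normrM ler_piMl// ger0_norm; lra.
  have e2 : `|q - a (k0 + i)%N * c (k0 + i)%N| <= `|kappa| + C.
    rewrite -[X in `|X|](subrK kappa) (le_trans (ler_normD _ _))//; lra.
  rewrite -natr1; lra.
set L := (K - k0)%N%:R : R.
set eta := C / k0.+1%:R * (B + (`|kappa| + C) * L).
have fine i : (k0 + i <= K)%N -> `|mu (k0 + i)%N - kappa * i%:R| <=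
    B + i%:R * eta + C * (\sum_(k0 <= j < k0 + i) j.+1%:R^-1).
  elim: i => [_|i IH iK].
    by rewrite addn0 mulr0 subr0 mul0r addr0 big_geq// mulr0 addr0.
  have iK' : (k0 + i <= K)%N by apply: leq_trans iK; rewrite leq_add2l.
  have {}IH := IH iK'; have cr := crude _ iK'.
  have kk : (k0 <= k0 + i < K)%N by rewrite leq_addr/= -addnS.
  have hk := h1 _ kk.
  rewrite addnS big_nat_recr ?leq_addr//= mulrDr.
  rewrite /mu/= -/(mu (k0 + i)%N) -natr1.
  set M := mu _ in IH cr *; set k := (k0 + i)%N in IH cr hk *.
  have -> : (1 - a k) * M + (q - a k * c k) - kappa * (i%:R + 1) =
    (M - kappa * i%:R) + (q - a k * c k - kappa) - a k * M by ring.
  have /andP[l0 l1] := a01 k.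
  have aM : `|a k * M| <= eta.
    rewrite normrM (ger0_norm l0) /eta; apply: ler_pM => //.
      apply: le_trans (aC k) _; rewrite ler_wpM2l// lef_pV2 ?posrE ?ltr0n//.
      by rewrite ler_nat ltnS leq_addr.
    apply: le_trans cr _; rewrite lerD2l ler_wpM2l ?addr_ge0//.
    by rewrite ler_nat leq_subRL.
  rewrite (le_trans (ler_normB _ _))// (le_trans (lerD (ler_normD _ _) (lexx _)))//.
  apply: le_trans (lerD (lerD IH hk) aM) _.
  by rewrite le_eqVlt; apply/orP; left; apply/eqP; ring.
have e : (k0 + (K - k0))%N = K by rewrite subnKC.
have := fine (K - k0)%N; rewrite e => /(_ (leqnn _)) /le_trans; apply.
have := harm k0 K k0K (leqnn _); rewrite -/L -/eta /B; lra.
Qed.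

End mean_shift.

(** * Comparison of powers of [n] *)

Section powers.
Context {R : realType}.

Lemma le_powR_near (e B : R) : 0 < e -> \forall n \near \oo, B <= n%:R `^ e.
Proof.
move=> e0; near=> n.
have h : (Num.max 1 B) `^ e^-1 <= n%:R by near: n; exact: nbhs_infty_ger.
have M1 : 1 <= Num.max 1 B by rewrite le_max lexx.
apply: (@le_trans _ _ (Num.max 1 B)); first by rewrite le_max lexx orbT.
have -> : Num.max 1 B = (Num.max 1 B `^ e^-1) `^ e.
  by rewrite -powRrM mulVf ?gt_eqF// powRr1//; lra.
by apply: ge0_ler_powR; rewrite ?nnegrE ?powR_ge0// ltW.
Unshelve. all: by end_near. Qed.

Lemma powR_superdiffusive (gamma B : R) : 1 / 2 < gamma ->
  \forall n \near \oo, B * Num.sqrt n%:R <= n%:R `^ gamma.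
Proof.
move=> g; near=> n.
have n0 : 0 < (n%:R : R) by rewrite ltr0n; near: n; exact: nbhs_infty_gt.
have h : B <= n%:R `^ (gamma - 1 / 2).
  by near: n; apply: le_powR_near; rewrite subr_gt0.
have -> : gamma = (gamma - 1 / 2) + 2^-1 by field.
rewrite powRD; last by rewrite (gt_eqF n0) implybT.
by rewrite powR12_sqrt ?(ltW n0)// ler_wpM2r// sqrtr_ge0.
Unshelve. all: by end_near. Qed.

Lemma powR_sublinear (gamma eps : R) : gamma < 1 -> 0 < eps ->
  \forall n \near \oo, n%:R `^ gamma <= eps * n%:R.
Proof.
move=> g eps0; near=> n.
have n0 : 0 < (n%:R : R) by rewrite ltr0n; near: n; exact: nbhs_infty_gt.
have h : eps^-1 <= n%:R `^ (1 - gamma).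
  by near: n; apply: le_powR_near; rewrite subr_gt0.
have -> : eps * n%:R = n%:R `^ gamma * (eps * n%:R `^ (1 - gamma)).
  rewrite mulrCA -powRD; last by rewrite (gt_eqF n0) implybT.
  by rewrite addrC subrK powRr1// ltW.
apply: ler_peMr; first exact: powR_ge0.
by rewrite mulrC -ler_pdivrMr// mul1r.
Unshelve. all: by end_near. Qed.

End powers.

(** * The mean under the alternative *)

Section alternative_model.
Context {R : realType} (m : nat) (delta0 delta1 : R).
Hypothesis m0 : (0 < m)%N.
Hypothesis hdelta0 : - m%:R < delta0.
Hypothesis hdelta1 : - m%:R < delta1.

(** The limiting drift once [delta1] is in force: [q] minus [p / m] times the loss rate of [delta1],
    rewritten by [hit_probE]. *)
Definition drift_shift : R :=
  p_m m delta0 * (loss_rate m delta0 - loss_rate m delta1) / m%:R.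

Lemma drift_shift_neq0 : delta0 <> delta1 -> drift_shift != 0.
Proof.
move=> d01; have mR : 0 < (m%:R : R) by rewrite ltr0n.
have /andP[p0 _] := p_m01 m delta0 m0 hdelta0.
have h0 := hdelta0; have h1 := hdelta1.
have E : loss_rate m delta0 - loss_rate m delta1 = m%:R ^+ 2 * (delta0 - delta1) /
    ((2 * m%:R + delta0) * (2 * m%:R + delta1)).
  by rewrite /loss_rate; field; rewrite !gt_eqF//; lra.
have D0 : 0 < 2 * m%:R + delta0 by lra.
have D1 : 0 < 2 * m%:R + delta1 by lra.
have d01' : delta0 - delta1 != 0 by rewrite subr_eq0; exact/eqP.
have mn : (m%:R : R) != 0 by rewrite gt_eqF.
have pn : p_m m delta0 != 0 by rewrite gt_eqF.
have D0n : 2 * m%:R + delta0 != 0 by rewrite gt_eqF.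
have D1n : 2 * m%:R + delta1 != 0 by rewrite gt_eqF.
by rewrite /drift_shift E mulf_neq0 ?invr_neq0// mulf_neq0// mulf_neq0 ?invr_neq0 ?mulf_neq0//.
Qed.

Lemma alternative_mean_shift : exists2 C : R, 0 <= C &
  forall n tau : nat, (0 < tau <= n)%N ->
  let a := step_rate m (delta_alt delta0 delta1 tau) in
  let B := `|2 - p_m m delta0| + 4 * C * Num.sqrt (Num.sqrt (m * n.-1)%N%:R) in
  let L := (m * (n - tau))%N%:R in
  (forall k, 0 <= a k <= 1) /\
  `|chain_mean a (center m (p_m m delta0) (hit_prob m delta0)) (hit_prob m delta0)
       (2 - p_m m delta0) (m * n.-1)%N - drift_shift * L| <=
    2 * B + L * (C / (m * tau.-1).+1%:R * (B + (`|drift_shift| + C) * L)).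
Proof.
have p01 : 0 <= p_m m delta0 <= 1 by have /andP[? ?] := p_m01 m delta0 m0 hdelta0; lra.
have pq := p_m_hit_prob m delta0 m0.
have [C0 C01 HC0] := step_drift_bounds m m0 delta0 _ _ hdelta0 p01 pq.
have [C1 C11 HC1] := step_drift_bounds m m0 delta1 _ _ hdelta1 p01 pq.
exists (C0 + C1) => [|n tau /andP[tau0 taun] a B L]; first by lra.
have le0 k : C0 / k.+1%:R <= (C0 + C1) / k.+1%:R by rewrite ler_wpM2r ?invr_ge0//; lra.
have le1 k : C1 / k.+1%:R <= (C0 + C1) / k.+1%:R by rewrite ler_wpM2r ?invr_ge0//; lra.
(* Step [k] belongs to vertex [k %/ m + 2], which is at most [tau] exactly when
   [k < m (tau - 1)]. *)
have early k : (k < m * tau.-1)%N ->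
    delta_alt delta0 delta1 tau (step_vertex m k) = delta0.
  move=> kt; rewrite /delta_alt /step_vertex lez_nat ifT//.
  have : (k %/ m < tau.-1)%N by rewrite ltn_divLR// mulnC.
  by case: (tau) tau0.
have late k : (m * tau.-1 <= k)%N ->
    delta_alt delta0 delta1 tau (step_vertex m k) = delta1.
  move=> kt; rewrite /delta_alt /step_vertex lez_nat ifF//.
  have : (tau.-1 <= k %/ m)%N by rewrite leq_divRL// mulnC.
  by rewrite leqNgt; case: (tau) tau0 => // t _ /= h; apply/negbTE; rewrite -ltnNge; lia.
have a01 k : 0 <= a k <= 1.
  have [kt|kt] := ltnP k (m * tau.-1).
    by have [] := HC0 _ k (early k kt).
  by have [] := HC1 _ k (late k kt).
split=> //.
have -> : L = (m * n.-1 - m * tau.-1)%N%:R.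
  rewrite /L; congr (_%:R); rewrite -mulnBr; congr (m * _)%N.
  by case: (tau) (n) tau0 taun => [//|t] [|n'].
apply: chain_mean_shift => //.
- by rewrite leq_mul2l; apply/orP; right; rewrite -!subn1 leq_sub2r.
- by lra.
- move=> k; have [kt|kt] := ltnP k (m * tau.-1).
    by have [_ h _ _] := HC0 _ k (early k kt); apply: le_trans h _.
  by have [_ h _ _] := HC1 _ k (late k kt); apply: le_trans h _.
- move=> k kt; have [_ _ _ h] := HC0 _ k (early k kt).
  apply: le_trans (le0 k); rewrite -hit_probE// in h.
  by rewrite distrC.
- move=> k /andP[kt _]; have [_ _ _ h] := HC1 _ k (late k kt).
  apply: le_trans (le1 k); apply: le_trans h.
  rewrite -normrN le_eqVlt; apply/orP; left; apply/eqP; congr `|_|.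
  have := hit_probE m delta0 m0 hdelta0; rewrite /drift_shift => ->.
  by rewrite -/a; ring.
Qed.

End alternative_model.

(** * The type-II error *)

Section type_II.
Context {R : realType} (m : nat) (delta0 delta1 c gamma : R).
Hypothesis m0 : (0 < m)%N.
Hypothesis hdelta0 : - m%:R < delta0.
Hypothesis hdelta1 : - m%:R < delta1.
Hypothesis c0 : 0 < c.
Hypothesis delta01 : delta0 <> delta1.
Hypothesis gamma_itv : 1 / 2 < gamma < 1.

Let p := p_m m delta0.
Let q := hit_prob m delta0.

(** Rounding down adds less than 1 to [n - tau], absorbed by the factor 2 as [c n^gamma >= 1]
    eventually; and [4 c n^gamma <= n] keeps [tau] above [n / 2]. *)
Lemma changepoint_near : \forall n \near \oo, exists2 tau : nat,
  changepoint c gamma n = tau /\ (0 < tau <= n)%N &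
  c * n%:R `^ gamma <= (n - tau)%N%:R <= 2 * c * n%:R `^ gamma /\ n%:R <= 2 * tau%:R :> R.
Proof.
have /andP[g0 g1] := gamma_itv; have c0' := c0.
have eps0 : 0 < (4 * c)^-1 by rewrite invr_gt0 mulr_gt0.
have H1 := powR_sublinear gamma _ g1 eps0.
have H2 := powR_superdiffusive gamma c^-1 g0.
near=> n.
have n4 : 4 <= (n%:R : R) by near: n; exact: nbhs_infty_ger.
have x1 : n%:R `^ gamma <= (4 * c)^-1 * n%:R by near: n; exact: H1.
have x2 : c^-1 * Num.sqrt n%:R <= n%:R `^ gamma by near: n; exact: H2.
set x := n%:R `^ gamma in x1 x2 *.
have cx1 : 1 <= c * x.
  have s1 : 1 <= Num.sqrt (n%:R : R) by rewrite -[leLHS]sqrtr1 ler_wsqrtr//; lra.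
  by rewrite (le_trans s1)// -ler_pdivrMl.
have cx2 : 4 * (c * x) <= n%:R.
  by have := x1; rewrite ler_pdivlMl ?mulr_gt0//; lra.
have := floor_itv (n%:R - c * x); rewrite -/(changepoint c gamma n).
set t := changepoint c gamma n => /andP[t1 t2].
have tpos : 0 < t.
  rewrite -(ltr0z R); have : 1 + (t%:~R : R) = (t + 1)%:~R by rewrite intrD addrC.
  by lra.
have tE : t = `|t|%N by rewrite gez0_abs// ltW.
have tR : (t%:~R : R) = `|t|%N%:R by rewrite {1}tE.
have t2' : n%:R - c * x < `|t|%N%:R + 1 by rewrite -tR -[1]/(1%:~R) -intrD.
rewrite tR in t1.
have tn : (`|t| <= n)%N by rewrite -(ler_nat R); lra.
exists `|t|%N; first by split => //; rewrite absz_gt0 gt_eqF.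
by rewrite natrB//; split; [apply/andP; split|]; lra.
Unshelve. all: by end_near. Qed.

(** With [A] the absolute drift shift and [L = m (n - tau)], the displacement [A L] loses at most
    [2 B <= A L / 4] to initial and harmonic terms and [A L / 4] to damping; the rest, [A L / 2],
    exceeds [|M| sqrt n]. *)
Lemma alternative_mean_large (M : R) : \forall n \near \oo,
  let a := step_rate m (delta_alt delta0 delta1 (changepoint c gamma n)) in
  (forall k, 0 <= a k <= 1) /\
  M * Num.sqrt n%:R <= `|chain_mean a (center m p q) q (2 - p) (m * n.-1)%N|.
Proof.
have /andP[g0 g1] := gamma_itv; have c0' := c0.
have mR : 1 <= (m%:R : R) by rewrite ler1n.
set A := `|drift_shift m delta0 delta1|.
have A0 : 0 < A by rewrite normr_gt0; exact: drift_shift_neq0.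
have [C C0 HC] := alternative_mean_shift m delta0 delta1 m0 hdelta0 hdelta1.
pose Y := `|2 - p| + 4 * C * m%:R.
have Y0 : 0 <= Y by rewrite addr_ge0// !mulr_ge0//; lra.
(* [B1] secures [8 B + 2 |M| sqrt n <= A L], as [n^gamma] outweighs [sqrt n]; [D] secures the
   damping bound, as [n^gamma] is small against [n]. *)
pose B1 := 8 * Y / (A * c) + 2 * `|M| / (A * c).
pose D := 4 * C * (2 * A + C) * m%:R * c.
have D0 : 0 <= D by rewrite !mulr_ge0// ?addr_ge0// ?mulr_ge0//; lra.
have eps0 : 0 < A / (4 * (D + 1)) by rewrite divr_gt0// mulr_gt0//; lra.
have H1 := powR_sublinear gamma _ g1 eps0.
have H2 := powR_superdiffusive gamma B1 g0.
have H3 := changepoint_near.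
near=> n.
have n0 : (0 < n)%N by near: n; exact: nbhs_infty_gt.
have nR : 1 <= (n%:R : R) by rewrite ler1n.
have x1 : n%:R `^ gamma <= A / (4 * (D + 1)) * n%:R by near: n; exact: H1.
have x2 : B1 * Num.sqrt n%:R <= n%:R `^ gamma by near: n; exact: H2.
have [tau [tE taun] [lx nt]] : exists2 tau : nat,
    changepoint c gamma n = tau /\ (0 < tau <= n)%N &
    c * n%:R `^ gamma <= (n - tau)%N%:R <= 2 * c * n%:R `^ gamma /\ n%:R <= 2 * tau%:R :> R.
  by near: n; exact: H3.
rewrite tE; set x : R := n%:R `^ gamma in x1 x2 lx *.
have x0 : 0 <= x by exact: powR_ge0.
have [a01 Hmu] := HC n tau taun; split=> //; move: Hmu.
set mu := chain_mean _ _ _ _ _; rewrite -/p -/A natrM.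
set l : R := (n - tau)%N%:R in lx *; set s := Num.sqrt n%:R in x2 *.
have /andP[l1 l2] := lx.
set r := Num.sqrt (Num.sqrt _).
have s1 : 1 <= s by rewrite -[leLHS]sqrtr1 ler_wsqrtr.
have rs : r <= m%:R * s.
  have ms1 : 1 <= m%:R * s by apply: (le_trans s1); apply: ler_peMl => //; exact: le_trans s1.
  have ms0 : 0 <= m%:R * s by lra.
  have -> : m%:R * s = Num.sqrt (Num.sqrt ((m%:R * s) ^+ 4)).
    by rewrite -[4%N]/(2 * 2)%N exprM sqrtr_sqr (ger0_norm (sqr_ge0 _)) sqrtr_sqr ger0_norm.
  apply: ler_wsqrtr; apply: ler_wsqrtr.
  have s2 : s ^+ 2 = n%:R by rewrite sqr_sqrtr.
  have h : m%:R * n%:R <= (m%:R * s) ^+ 2 by rewrite exprMn s2 ler_wpM2r// ler_eXnr.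
  apply: le_trans (_ : (m%:R * s) ^+ 2 <= _); last exact: ler_weXn2l.
  by apply: le_trans h; rewrite natrM ler_wpM2l// ler_nat leq_pred.
set B := `|2 - p| + 4 * C * r.
have BY : B <= Y * s.
  have y0 : 0 <= `|2 - p| by [].
  have h1 : `|2 - p| <= `|2 - p| * s by rewrite ler_peMr.
  have h2 : 4 * C * r <= 4 * C * (m%:R * s) by rewrite ler_wpM2l// mulr_ge0.
  by rewrite /B /Y; lra.
have s0 : 0 <= s by lra.
set L := m%:R * l.
have cx0 : 0 <= c * x by rewrite mulr_ge0// ltW.
have lL : l <= L by apply: ler_peMl => //; lra.
have L0 : 0 <= L by lra.
have ALx : A * c * x <= A * L by rewrite -mulrA ler_wpM2l ?(ltW A0)//; lra.
have Ac0 : 0 < A * c by rewrite mulr_gt0.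
have YM : 8 * Y * s + 2 * `|M| * s <= A * L.
  apply: le_trans ALx; have := ler_wpM2l (ltW Ac0) x2.
  by apply: le_trans; rewrite le_eqVlt; apply/orP; left; apply/eqP; rewrite /B1; field;
    rewrite !gt_eqF.
have Ms0 : 0 <= `|M| * s by rewrite mulr_ge0.
have BL : 8 * B <= A * L by lra.
have k1 : n%:R <= 2 * (m * tau.-1).+1%:R :> R.
  apply: le_trans nt _; rewrite ler_wpM2l// ler_nat.
  have /andP[t0 _] := taun; rewrite -[leqLHS](prednK t0) ltnS.
  exact: leq_pmull.
set kk : R := (m * tau.-1).+1%:R in k1 *.
have kk0 : 0 < kk by rewrite /kk ltr0n.
have eta : C / kk * (B + (A + C) * L) <= A / 4.
  rewrite mulrAC ler_pdivrMr//.
  have b1 : B + (A + C) * L <= (2 * A + C) * L by have := mulr_ge0 (ltW A0) L0; lra.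
  have b2 : C * (B + (A + C) * L) <= C * ((2 * A + C) * L) by rewrite ler_wpM2l.
  have b3 : C * ((2 * A + C) * L) <= C * ((2 * A + C) * (m%:R * (2 * c * x))).
    by rewrite ler_wpM2l// ler_wpM2l ?addr_ge0 ?mulr_ge0 ?(ltW A0)// ler_wpM2l.
  have b4 : 2 * (C * ((2 * A + C) * (m%:R * (2 * c * x)))) = D * x by rewrite /D; ring.
  have b5 : D * x <= A / 4 * n%:R.
    apply: le_trans (_ : (D + 1) * x <= _); first by rewrite ler_wpM2r//; lra.
    have D1 : 0 < D + 1 by lra.
    have := ler_wpM2l (ltW D1) x1; move/le_trans; apply.
    by rewrite le_eqVlt; apply/orP; left; apply/eqP; field; rewrite gt_eqF.
  have b6 : A / 4 * n%:R <= A / 4 * (2 * kk) by rewrite ler_wpM2l//; lra.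
  by lra.
have Leta := ler_wpM2l L0 eta.
have key : `|drift_shift m delta0 delta1 * L| = A * L by rewrite normrM (ger0_norm L0).
have tri : A * L <= `|mu| + `|mu - drift_shift m delta0 delta1 * L|.
  by rewrite -key -{1}[_ * L](subKr mu) (le_trans (ler_normB _ _)).
have Mle : M * s <= `|M| * s by rewrite ler_wpM2r// ler_norm.
have Ys0 : 0 <= Y * s by rewrite mulr_ge0.
move=> h; have h2 := lerD (le_trans h (lerD (lexx _) Leta)) (lexx `|mu|); lra.
Unshelve. all: by end_near. Qed.

Lemma type_II_error (alpha : R) (d : nat -> measure_display)
    (T : forall n, measurableType (d n)) (P : forall n, probability (T n) R)
    (v : forall n, nat -> nat -> T n -> nat) :
  (forall n, is_pa_process m (delta_alt delta0 delta1 (changepoint c gamma n))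
     (P n) (v n)) ->
  P n [set w | psi_cal m delta0 alpha n (random_graph m (v n) n w) = 0%N] @[n --> \oo]
    --> 0%:E.
Proof.
move=> HP; set z := z_quantile (alpha / 2).
have mR : 1 <= (m%:R : R) by rewrite ler1n.
pose b := Num.sqrt (w_var delta0 m) * z.
pose L n := chain_expectation m (P n) (v n) p q (m * n.-1)%N.
have chainL n := chain_expectation_bernoulli m _ (P n) (v n) p q m0 (HP n).
pose u n := L n (fun y => (~~ (b * Num.sqrt n%:R <= `|y|)%R)%:R).
suff lim : u n @[n --> \oo] --> (0 : R).
  have : (EFin \o u) @ \oo --> 0%:E by apply: cvg_EFin; [exact: nearW|exact: lim].
  apply: cvg_trans; apply: near_eq_cvg; near=> n.
  have n0 : (0 < n)%N by near: n; exact: nbhs_infty_gt.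
  rewrite /= /u -(chain_expectation_prob _ _ _ _ _ _ m0 (HP n)).
  congr (P n _).
  have E x : psi_cal m delta0 alpha n (random_graph m (v n) n x) =
      (b * Num.sqrt n%:R <= `|centered_count m (v n) p q (m * n.-1) x|)%R :> nat.
    rewrite psi_calE// -/z sqrtrM//; congr (nat_of_bool (_ <= _)); rewrite /b; ring.
  by apply/seteqP; split => x /=; rewrite E; case: (_ <= _).
apply/cvgrPdist_le => e e0.
(* With [s = sqrt n], acceptance means [|y| < b s], so [y] is at least [(1 + m / e) s] away from the
   mean; Chebyshev bounds this by [m n / (4 (1 + m / e)^2 n) <= e]. *)
pose M := `|b| + 1 + m%:R / e.
have H := alternative_mean_large M.
near=> n.
have [a01 Hmu] : let a := step_rate m (delta_alt delta0 delta1 (changepoint c gamma n)) in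
  (forall k, 0 <= a k <= 1) /\
  M * Num.sqrt n%:R <= `|chain_mean a (center m p q) q (2 - p) (m * n.-1)%N|.
  by near: n; exact: H.
have n0 : (0 < n)%N by near: n; exact: nbhs_infty_gt.
have nR : 1 <= (n%:R : R) by rewrite ler1n.
have hd t : - m%:R < delta_alt delta0 delta1 (changepoint c gamma n) t.
  by rewrite /delta_alt; case: ifP.
have HL := chainL n hd (p_m_hit_prob m delta0 m0).
set mu := chain_mean _ _ _ _ _ in Hmu.
set s := Num.sqrt n%:R in Hmu *.
have s1 : 1 <= s by rewrite -[leLHS]sqrtr1 ler_wsqrtr.
have s2 : s ^+ 2 = n%:R by rewrite sqr_sqrtr.
have me0 : 0 <= m%:R / e by rewrite divr_ge0// ltW.
pose h := (1 + m%:R / e) * s.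
have h0 : 0 < h by rewrite mulr_gt0//; lra.
have u0 : 0 <= u n.
  by rewrite -[0](chain_cst _ _ _ _ _ HL (m * n.-1)); apply: (chain_le _ _ _ _ _ HL).
have bs : b * s <= `|b| * s by rewrite ler_wpM2r ?ler_norm//; lra.
have uh : u n <= L n (fun y => (h <= `|y - mu|)%R%:R).
  apply: (chain_le _ _ _ _ _ HL) => y; rewrite -/s -ltNge.
  have t : `|mu| <= `|y| + `|y - mu|.
    by rewrite -{1}[mu](subKr y) (le_trans (ler_normB _ _)).
  case: (ltP `|y|) => // yb; have -> : h <= `|y - mu|.
    by move: Hmu; rewrite /M /h; lra.
  by [].
have ch := chain_chebyshev _ _ _ _ _ HL a01 (m * n.-1)%N h h0.
rewrite sub0r normrN ger0_norm// (le_trans uh)// (le_trans ch)//.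
rewrite ler_pdivrMr; last by rewrite mulr_gt0// exprn_gt0.
have K : (m * n.-1)%N%:R <= m%:R * n%:R :> R by rewrite natrM ler_wpM2l// ler_nat leq_pred.
have k2 : 1 + m%:R / e <= (1 + m%:R / e) ^+ 2 by rewrite ler_eXnr//; lra.
have k3 : m%:R <= e * (4 * (1 + m%:R / e) ^+ 2).
  have := ler_wpM2l (ltW e0) k2; rewrite mulrDr mulr1 (mulrC e (_ / _)) divfK ?gt_eqF//.
  by lra.
by rewrite /h exprMn s2 mulrA mulrA -[X in _ <= X * _]mulrA; apply: le_trans K _; rewrite ler_wpM2r.
Unshelve. all: by end_near. Qed.

End type_II.

Theorem theorem3p5 (R : realType) (m : nat) (delta0 alpha : R)
    (hm : (1 <= m)%N) (hdelta0 : - m%:R < delta0)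
    (halpha : 0 < alpha < 1) :
  (forall (d : measure_display) (T : measurableType d) (P0 : probability T R)
      (v : nat -> nat -> T -> nat),
    is_pa_process m (delta_null delta0) P0 v ->
    (fun n : nat =>
       P0 [set w | psi_cal m delta0 alpha n (random_graph m v n w) <> 0%N])
      @ \oo --> alpha%:E)
  /\
  (forall (delta1 c gamma : R),
    - m%:R < delta1 -> 0 < c -> delta0 <> delta1 -> 1 / 2 < gamma < 1 ->
    forall (d : nat -> measure_display) (T : forall n : nat, measurableType (d n))
      (P1 : forall n : nat, probability (T n) R)
      (v : forall n : nat, nat -> nat -> T n -> nat),
    (forall n : nat,
      is_pa_process m (delta_alt delta0 delta1 (changepoint c gamma n))
        (P1 n) (v n)) ->
    (fun n : nat =>
       P1 n [set w | psi_cal m delta0 alpha n (random_graph m (v n) n w) = 0%N])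
      @ \oo --> 0%:E).
Proof.
split=> [d T P0 v HP|delta1 c gamma hd1 c0 d01 hg d T P1 v HP].
- exact: type_I_error HP _ halpha.
- exact: (type_II_error m delta0 delta1 c gamma hm hdelta0 hd1 c0 d01 hg alpha).
Qed.
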